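(* Let $R$ be a commutative Noetherian semiperfect ring, let $C$ be a semidualizing $R$-module, and let $M$ be a finite $R$-module of finite $\mathrm{G}_C$-dimension. Then, for any given $i>0$, $$\mathrm{grade}_R(\mathrm{Ext}_R^i(M,C))\ge i.$$
   Context: A commutative Noetherian ring is semiperfect iff it is a finite direct product of local rings. ''Finite'' module means finitely generated. A finite $R$-module $C$ is semidualizing if the homothety map $R\to\mathrm{Hom}_R(C,C)$ is an isomorphism and $\mathrm{Ext}^i_R(C,C)=0$ for all $i>0$. Write $(-)^C=\mathrm{Hom}_R(-,C)$. A finite module $X$ is totally $C$-reflexive if the biduality map $X\to X^{CC}$ is an isomorphism and $\mathrm{Ext}^i_R(X,C)=\mathrm{Ext}^i_R(X^C,C)=0$ for all $i>0$. For a finite module $M$, $\mathrm{G}_C\text{-}\dim_R(M)$ is the smallest $n\ge 0$ such that there is an exact sequence $0\to X_n\to\cdots\to X_0\to M\to 0$ with all $X_i$ totally $C$-reflexive, and $\infty$ if no such $n$ exists. $\mathrm{grade}_R(M)=\inf\{i\ge 0\mid \mathrm{Ext}^i_R(M,R)\ne 0\}$, with $\mathrm{grade}_R(0)=\infty$. *)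

(* Defs.v *)
From HB Require Import structures.
From mathcomp Require Import all_boot all_algebra.
From mathcomp Require Import boolp classical_sets cardinality functions fsbigop.

Set Implicit Arguments.
Unset Strict Implicit.
Unset Printing Implicit Defensive.

Import GRing.Theory.
Local Open Scope classical_set_scope.
Local Open Scope ring_scope.
Local Open Scope quotient_scope.

(* Natural numbers or infinity, the latter being None. *)
Definition enat := option nat.

(* The infimum of the set of naturals satisfying P, hence None if it is empty. *)
Definition einf (P : nat -> Prop) : enat :=
  if pselect (exists n, `[< P n >]) is left exP then Some (ex_minn exP) else None.

Definition leqe (n : nat) (m : enat) : bool :=
  if m is Some k then (n <= k)%N else true.

Section Rings.
Variable R : comPzRingType.

Definition ideal (I : {pred R}) : Prop := submod_closed (I : {pred R^o}).

Definition noetherian : Prop :=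
  forall I : {pred R}, ideal I ->
    exists n (g : 'I_n -> R),
      forall x, x \in I <-> exists c : 'I_n -> R, x = \sum_i c i * g i.

Definition maximal_ideal (I : {pred R}) : Prop :=
  [/\ ideal I, 1 \notin I &
      forall J : {pred R}, ideal J -> 1 \notin J -> {subset I <= J} -> J =i I].

Definition local_ring : Prop :=
  exists2 I : {pred R}, maximal_ideal I &
    forall J : {pred R}, maximal_ideal J -> J =i I.

End Rings.

(* For commutative Noetherian R only, where being semiperfect amounts to being  *)
(* a finite direct product of local rings. The ring isomorphism from R to the   *)
(* product of the L i is given by its components f i. The zero ring is the      *)
(* product of the empty family.                                                 *)
Definition semiperfect (R : comPzRingType) : Prop :=
  exists n (L : 'I_n -> comPzRingType) (f : forall i, {rmorphism R -> L i}),
    (forall i, local_ring (L i)) /\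
    bijective (fun (r : R) => (fun i => f i r) : forall i, L i).

Section Modules.
Variable R : comPzRingType.

Definition zero_module (M : lmodType R) : Prop := forall x : M, x = 0.

Definition finite_module (M : lmodType R) : Prop :=
  exists n (g : 'I_n -> M),
    forall x, exists c : 'I_n -> R, x = \sum_i c i *: g i.

End Modules.

Definition HomR (R : comPzRingType) (M N : lmodType R) : Type := {linear M -> N}.

Section HomModule.
Variables (R : comPzRingType) (M N : lmodType R).
Implicit Types f g h : HomR M N.

HB.instance Definition _ := gen_eqMixin (HomR M N).
HB.instance Definition _ := gen_choiceMixin (HomR M N).

Lemma Hom_eq f g : f =1 g -> f = g.
Proof.
case: f g => [f [[cf] [df]]] [g [[cg] [dg]]] /= /funext fg.
move: cf df cg dg; rewrite /= in fg *; rewrite fg => cf df cg dg.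
by rewrite (Prop_irrelevance cf cg) (Prop_irrelevance df dg).
Qed.

Definition Hom_zero : HomR M N := \0.
Definition Hom_opp f : HomR M N := \- f.
Definition Hom_add f g : HomR M N := f \+ g.
Definition Hom_scale (a : R) f : HomR M N := a \*: f.

Lemma Hom_addA : associative Hom_add.
Proof. by move=> f g h; apply: Hom_eq => x /=; rewrite addrA. Qed.

Lemma Hom_addC : commutative Hom_add.
Proof. by move=> f g; apply: Hom_eq => x /=; rewrite addrC. Qed.

Lemma Hom_add0 : left_id Hom_zero Hom_add.
Proof. by move=> f; apply: Hom_eq => x /=; rewrite add0r. Qed.

Lemma Hom_addN : left_inverse Hom_zero Hom_opp Hom_add.
Proof. by move=> f; apply: Hom_eq => x /=; rewrite addNr. Qed.

HB.instance Definition _ :=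
  GRing.isZmodule.Build (HomR M N) Hom_addA Hom_addC Hom_add0 Hom_addN.

Lemma Hom_scaleA a b f : Hom_scale a (Hom_scale b f) = Hom_scale (a * b) f.
Proof. by apply: Hom_eq => x /=; rewrite scalerA. Qed.

Lemma Hom_scale1 : left_id 1 Hom_scale.
Proof. by move=> f; apply: Hom_eq => x /=; rewrite scale1r. Qed.

Lemma Hom_scaleDr : right_distributive Hom_scale +%R.
Proof. by move=> a f g; apply: Hom_eq => x /=; rewrite scalerDr. Qed.

Lemma Hom_scaleDl f : {morph Hom_scale^~ f : a b / a + b}.
Proof. by move=> a b; apply: Hom_eq => x /=; rewrite scalerDl. Qed.

HB.instance Definition _ := GRing.Zmodule_isLmodule.Build R (HomR M N)
  Hom_scaleA Hom_scale1 Hom_scaleDr Hom_scaleDl.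

End HomModule.

(* Hom(u, N) *)
Definition Hom_pre (R : comPzRingType) (M M' N : lmodType R) (u : HomR M M')
  (f : HomR M' N) : HomR M N := f \o u.

Section HomPre.
Variables (R : comPzRingType) (M M' N : lmodType R) (u : HomR M M').

Lemma Hom_pre_linear : linear (@Hom_pre R M M' N u).
Proof. by move=> a f g; apply: Hom_eq. Qed.

HB.instance Definition _ :=
  GRing.isLinear.Build R (HomR M' N) (HomR M N) _ (@Hom_pre R M M' N u)
    Hom_pre_linear.

End HomPre.

Section Kernel.
Variables (R : comPzRingType) (M N : lmodType R) (f : HomR M N).

Definition ker_pred : {pred M} := [pred x | f x == 0].

Lemma ker_pred_closed : submod_closed ker_pred.
Proof.
split=> [|a x y]; rewrite !inE ?linear0 // linearP => /eqP-> /eqP->.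
by rewrite scaler0 addr0.
Qed.

HB.instance Definition _ :=
  GRing.isSubmodClosed.Build R M ker_pred ker_pred_closed.

Record kermod : Type := Ker { ker_val : M; _ : ker_val \in ker_pred }.

HB.instance Definition _ := [isSub for ker_val].
HB.instance Definition _ := [Choice of kermod by <:].
HB.instance Definition _ := [SubChoice_isSubLmodule of kermod by <:].

Definition ker_incl : HomR kermod M := (val : kermod -> M).

End Kernel.

Section Free.
Variables (R : comPzRingType) (X : choiceType).

Definition finsupp_pred : {pred X -> R^o} :=
  [pred f : X -> R^o | `[< finite_set [set x | f x != 0] >]].

Lemma finsupp_pred_closed : submod_closed finsupp_pred.
Proof.
split=> [|a f g /asboolP fF /asboolP gF]; apply/asboolP.
  by apply: (sub_finite_set (B := set0)) => // x /=; rewrite eqxx.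
apply: (sub_finite_set (B := [set x | f x != 0] `|` [set x | g x != 0])).
  move=> x /=; have [fx0|] := eqVneq (f x) 0; last by left.
  have [gx0|] := eqVneq (g x) 0; last by right.
  by rewrite !fctE fx0 gx0 scaler0 addr0 eqxx.
by rewrite finite_setU.
Qed.

HB.instance Definition _ :=
  GRing.isSubmodClosed.Build R (X -> R^o) finsupp_pred finsupp_pred_closed.

Record freemod : Type := Free { free_val : X -> R^o; _ : free_val \in finsupp_pred }.

HB.instance Definition _ := [isSub for free_val].
HB.instance Definition _ := [Choice of freemod by <:].
HB.instance Definition _ := [SubChoice_isSubLmodule of freemod by <:].

End Free.

Section Augmentation.
Variables (R : comPzRingType) (M : lmodType R).
Implicit Type f : freemod R M.

Definition aug_fun f : M := \sum_(x \in [set: M]) free_val f x *: x.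

Lemma aug_funE f (D : seq M) :
    uniq D -> (forall x, x \notin D -> free_val f x = 0) ->
  aug_fun f = \sum_(x <- D) free_val f x *: x.
Proof.
move=> Du fD; rewrite /aug_fun (fsbigE D) //.
  by apply: eq_bigl => x; rewrite in_setT.
by move=> x _ /fD->; rewrite scale0r.
Qed.

Lemma free_finsupp f : exists D : seq M, forall x, free_val f x != 0 -> x \in D.
Proof.
case: f => f /= /asboolP /finite_seqP[D fD]; exists D => x fx.
by have : [set x | f x != 0] x by []; rewrite fD.
Qed.

Lemma aug_fun_linear : linear aug_fun.
Proof.
move=> a f g; have [Df fD] := free_finsupp f; have [Dg gD] := free_finsupp g.
pose D := undup (Df ++ Dg).
have f0 x : x \notin D -> free_val f x = 0.
  rewrite mem_undup mem_cat => xD; apply/eqP; apply: contraNT xD.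
  by move/fD->.
have g0 x : x \notin D -> free_val g x = 0.
  rewrite mem_undup mem_cat => xD; apply/eqP; apply: contraNT xD.
  by move/gD->; rewrite orbT.
have Du : uniq D by exact: undup_uniq.
rewrite !(aug_funE Du) //; last first.
  by move=> x xD; rewrite /= !fctE f0 // g0 // scaler0 addr0.
rewrite scaler_sumr -big_split /=; apply: eq_bigr => x _.
by rewrite scalerDl scalerA.
Qed.

HB.instance Definition _ :=
  GRing.isLinear.Build R (freemod R M) M _ aug_fun aug_fun_linear.

Definition aug : HomR (freemod R M) M := aug_fun.

Lemma aug_surj (x : M) : exists f, aug f = x.
Proof.
pose e (y : M) : R^o := (y == x)%:R.
have eF : e \in @finsupp_pred R M.
  apply/asboolP; apply: (sub_finite_set (B := [set x])) => // y /=.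
  by rewrite /e; case: (eqVneq y x) => // _; rewrite eqxx.
exists (Free eF); rewrite /aug /= (aug_funE (D := [:: x])) //=.
  by rewrite big_seq1 /e eqxx scale1r.
by move=> y; rewrite inE /e => /negPf->.
Qed.

End Augmentation.

(* For u : A -> B and v : B -> C, the quotient of ker v by the image of u       *)
(* (more precisely by its intersection with ker v, if v u is not zero).         *)
Section Homology.
Variables (R : comPzRingType) (A B C : lmodType R) (u : HomR A B) (v : HomR B C).

Definition boundary : {pred kermod v} :=
  [pred z | `[< exists x, u x = ker_val z >]].

Lemma boundary_closed : submod_closed boundary.
Proof.
split=> [|a y z /asboolP[y' uy] /asboolP[z' uz]]; apply/asboolP.
  by exists 0; rewrite linear0.
by exists (a *: y' + z'); rewrite linearP uy uz.
Qed.

HB.instance Definition _ :=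
  GRing.isSubmodClosed.Build R (kermod v) boundary boundary_closed.

Definition homology : Type := Quotient.quot boundary.

HB.instance Definition _ := GRing.Zmodule.on homology.
HB.instance Definition _ := EqQuotient.copy homology (Quotient.quot boundary).
HB.instance Definition _ := ZmodQuotient.copy homology (Quotient.quot boundary).

Definition homology_scale (a : R) (x : homology) : homology :=
  \pi_homology (a *: repr x).

Lemma homology_pi (x : homology) : exists z, x = \pi_homology z.
Proof. by exists (repr x); rewrite reprK. Qed.

Lemma homology_scale_pi a (z : kermod v) :
  homology_scale a (\pi_homology z) = \pi_homology (a *: z).
Proof.
apply/eqP; rewrite -Quotient.idealrBE -scalerBr rpredZ //.
by rewrite Quotient.idealrBE reprK.
Qed.

Lemma homology_scaleA a b x :
  homology_scale a (homology_scale b x) = homology_scale (a * b) x.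
Proof. by have [z ->] := homology_pi x; rewrite !homology_scale_pi scalerA. Qed.

Lemma homology_scale1 : left_id 1 homology_scale.
Proof. by move=> x; have [z ->] := homology_pi x; rewrite homology_scale_pi scale1r. Qed.

Lemma homology_scaleDr : right_distributive homology_scale +%R.
Proof.
move=> a x y; have [z ->] := homology_pi x; have [t ->] := homology_pi y.
by rewrite -pi_addr !homology_scale_pi -pi_addr scalerDr.
Qed.

Lemma homology_scaleDl x : {morph homology_scale^~ x : a b / a + b}.
Proof.
move=> a b; have [z ->] := homology_pi x.
by rewrite !homology_scale_pi -pi_addr scalerDl.
Qed.

HB.instance Definition _ := GRing.Zmodule_isLmodule.Build R homology
  homology_scaleA homology_scale1 homology_scaleDr homology_scaleDl.

End Homology.

(* Ext is computed with the canonical free resolution                           *)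
(*   ... -> fres M 2 -> fres M 1 -> fres M 0 -> M -> 0,                         *)
(* in which every term is the free module on the underlying set of the          *)
(* preceding kernel.                                                            *)
Section Ext.
Variables (R : comPzRingType) (M : lmodType R).

Fixpoint syz (n : nat) : lmodType R :=
  if n is m.+1 then kermod (aug (syz m)) else M.

Definition fres (n : nat) : lmodType R := freemod R (syz n).

Definition res_d (n : nat) : HomR (fres n.+1) (fres n) :=
  ker_incl (aug (syz n)) \o aug (syz n.+1).

Lemma res_aug_exact (x : fres 0) :
  aug M x = 0 <-> exists y, res_d 0 y = x.
Proof.
split=> [/eqP x0|[y <-]]; last by apply/eqP; exact: (valP (aug (syz 1) y)).
by have [y yx] := aug_surj (Ker (f := aug M) x0); exists y; rewrite /= yx.
Qed.

Lemma res_exact n (x : fres n.+1) :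
  res_d n x = 0 <-> exists y, res_d n.+1 y = x.
Proof.
have -> : res_d n x = 0 <-> aug (syz n.+1) x = 0.
  by split=> [x0|/= -> //]; apply: val_inj.
split=> [/eqP x0|[y <-]]; last by apply/eqP; exact: (valP (aug (syz n.+2) y)).
by have [y yx] := aug_surj (Ker (f := aug (syz n.+1)) x0); exists y; rewrite /= yx.
Qed.

Variable N : lmodType R.

(* HomR (fres n.-1) N -> HomR (fres n) N, the zero map for n = 0. *)
Definition dual_d (n : nat) : HomR (HomR (fres n.-1) N) (HomR (fres n) N) :=
  if n is m.+1 then Hom_pre (N := N) (res_d m) else \0.

Definition Ext (n : nat) : lmodType R := homology (dual_d n) (dual_d n.+1).

End Ext.

Section GCdimension.
Variables (R : comPzRingType) (C : lmodType R).

Definition homothety (a : R) : HomR C C := a \*: idfun.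

Definition semidualizing : Prop :=
  [/\ finite_module C, bijective homothety &
      forall i, (0 < i)%N -> zero_module (Ext C C i)].

Definition eval_at (X : lmodType R) (x : X) (f : HomR X C) : C := f x.

Lemma eval_at_linear X x : linear (@eval_at X x).
Proof. by []. Qed.

HB.instance Definition _ X x :=
  GRing.isLinear.Build R (HomR X C) C _ (@eval_at X x) (@eval_at_linear X x).

Definition biduality (X : lmodType R) (x : X) : HomR (HomR X C) C := eval_at x.

Definition totally_reflexive (X : lmodType R) : Prop :=
  [/\ finite_module X, bijective (@biduality X),
      forall i, (0 < i)%N -> zero_module (Ext X C i) &
      forall i, (0 < i)%N -> zero_module (Ext (HomR X C) C i)].

(* An exact sequence 0 -> X n -> ... -> X 0 -> M -> 0 with all the X k totally  *)
(* C-reflexive; it is extended by X k = 0 for k > n.                            *)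
Definition GC_resolution (M : lmodType R) (n : nat) : Prop :=
  exists (X : nat -> lmodType R) (d : forall k, HomR (X k.+1) (X k))
         (e : HomR (X 0) M),
    [/\ forall k, (k <= n)%N -> totally_reflexive (X k),
        forall k, (n < k)%N -> zero_module (X k),
        forall y : M, exists x, e x = y,
        forall x, e x = 0 <-> exists x', d 0 x' = x &
        forall k x, d k x = 0 <-> exists x', d k.+1 x' = x].

Definition GCdim (M : lmodType R) : enat := einf (GC_resolution M).

End GCdimension.

Definition grade (R : comPzRingType) (M : lmodType R) : enat :=
  einf (fun i => ~ zero_module (Ext M R^o i)).

(* Main.v *)
From HB Require Import structures.
Require Import Defs.
From mathcomp Require Import all_boot all_algebra.
From mathcomp Require Import boolp classical_sets cardinality functions.

(* Write X^* = Hom(X, C).  Let X_k be a totally C-reflexive resolution of M,   *)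
(* with syzygies Y_k, so that E_k = Ext^k(M, C) is the cokernel of             *)
(* X_(k-1)^* -> Y_k^*, and let N = C/(r_1, ..., r_g)C for a C-regular          *)
(* sequence with g < k.  The complex Hom(X_*^*, N), which is X_* modulo the    *)
(* r_i, is exact in degrees > g.  By descending induction on k, some N-regular *)
(* y kills E_l for all l > k; then a power of y kills the obstruction to       *)
(* extending maps Y_k^* -> N to X_k^*, and the exactness gives Hom(E_k, N) = 0.*)
(* As R is Noetherian, E_k is then killed by an N-regular element.  Hence      *)
(* ann E_k contains a C-regular sequence of length k; it is also R-regular,    *)
(* since Hom(C, -) sends C to R and preserves the exactness of the sequences   *)
(* 0 -> N -> N -> N/rN -> 0, so Ext^l(E_k, R) = 0 for l < k.                   *)

Set Implicit Arguments.
Unset Strict Implicit.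
Unset Printing Implicit Defensive.

Import GRing.Theory.
Local Open Scope ring_scope.

(** Put E = Ext^i(M, C). The crux is that, for every quotient N of C by a regular sequence of length
    g < i, some N-regular r kills E ([regular_coker_kill], carried to Ext by [coker_kill_Ext]).
    Granting this, Ext^l(E, R) = 0 for l < i by induction on l ([Ext_hom_zero], [Ext_ring_zero]): R
    is Hom(C, C), and r acts on Ext^l(E, Hom(C, N)) as zero, because it kills E, and injectively,
    because Ext^(l-1)(E, Hom(C, N/rN)) = 0.

    The element r is obtained from Hom(E, N) = 0 by [regular_annihilator]. For this vanishing
    ([coker_hom_zero]), let f be a map to N from the dual of a syzygy that is zero on the image of
    the dual of the preceding term. By induction from the top, some N-regular y kills the higher
    cokernels, and a power of y makes f extend to the dual of the next term
    ([dual_torsion_extension]). The extension is a cycle in a complex that is exact there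
    ([bidual_exact]), hence a boundary, and so it restricts to zero; regularity of y gives f = 0.

    Long exact sequences enter only as statements on products of annihilators of Ext
    ([Ext_kill_left], [Ext_kill_right]); annihilation by 1 is vanishing. *)

(** * Linear maps, short exact sequences and free modules *)

Section LinearMaps.
Variable R : comPzRingType.
Implicit Types A B K M N : lmodType R.

Definition mkHom M N (f : M -> N) (f_linear : linear f) : HomR M N :=
  let m := GRing.isLinear.Build R M N _ f f_linear in HB.pack f m.

(** Two values at one point differ by a value at 0, so the relation is single-valued. This builds
    the maps that are prescribed by a relation rather than by a formula. *)
Lemma rel_hom M N (r : M -> N -> Prop) :
    (forall x, exists y, r x y) ->
    (forall a x y x' y', r x y -> r x' y' -> r (a *: x + x') (a *: y + y')) ->
    (forall y, r 0 y -> y = 0) ->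
  exists f : HomR M N, forall x, r x (f x).
Proof.
move=> r_total r_lin r0.
have [f rf] : {f : M -> N | forall x, r x (f x)}.
  exists (fun x => projT1 (cid (r_total x))) => x.
  exact: projT2 (cid (r_total x)).
have r_uniq x y y' : r x y -> r x y' -> y = y'.
  move=> ry ry'; apply/eqP; rewrite -subr_eq0; apply/eqP/r0.
  by have := r_lin (-1) _ _ _ _ ry' ry; rewrite !scaleN1r addNr addrC.
have lf : linear f by move=> a x y; apply: r_uniq (rf _) (r_lin _ _ _ _ _ _ _).
by exists (mkHom lf).
Qed.

Definition onto (S T : Type) (f : S -> T) := forall y, exists x, f x = y.

Lemma inj_hom M N (f : HomR M N) : (forall x, f x = 0 -> x = 0) -> injective f.
Proof.
move=> f0 x y fxy; apply/eqP; rewrite -subr_eq0; apply/eqP/f0.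
by rewrite linearB fxy subrr.
Qed.

Lemma hom_factor M N A (q : HomR M N) (f : HomR M A) :
    onto q -> (forall x, q x = 0 -> f x = 0) ->
  exists g : HomR N A, forall x, g (q x) = f x.
Proof.
move=> q_surj f0.
have [|a y z y' z' [x [<- <-]] [x' [<- <-]]|z [x [qx <-]]|g gP] :=
  @rel_hom N A (fun y z => exists x, q x = y /\ f x = z).
- by move=> y; have [x <-] := q_surj y; exists (f x); exists x.
- by exists (a *: x + x'); rewrite !linearP.
- exact: f0.
exists g => x; have [x' [qx' <-]] := gP (q x).
apply/eqP; rewrite -subr_eq0 -linearB; apply/eqP/f0.
by rewrite linearB qx' subrr.
Qed.

Lemma hom_lift_inj M N A (i : HomR M N) (f : HomR A N) :
    injective i -> (forall x, exists y, i y = f x) ->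
  exists g : HomR A M, forall x, i (g x) = f x.
Proof.
move=> i_inj fi.
have [||y iy|g gP] := @rel_hom A M (fun x y => i y = f x).
- exact: fi.
- by move=> a x y x' y' iy iy'; rewrite !linearP iy iy'.
- by apply: i_inj; rewrite iy !linear0.
by exists g.
Qed.

Definition ses K B A (i : HomR K B) (p : HomR B A) :=
  [/\ injective i, onto p & forall b, p b = 0 <-> exists k, i k = b].

Lemma ses_ker B A (p : HomR B A) : onto p -> ses (ker_incl p) p.
Proof.
move=> p_surj; split=> // b; split=> [/eqP b0|[k <-]]; first by exists (Ker (f := p) b0).
by apply/eqP; exact: (valP k).
Qed.

Lemma homology_pi0 A B K (u : HomR A B) (v : HomR B K) (z : kermod v) :
  \pi_(homology u v)%qT z = 0 <-> exists x, u x = ker_val z.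
Proof.
have <- : \pi_(homology u v)%qT 0 = 0 by exact: pi_zeror.
split=> [/eqP|uz]; last apply/eqP; rewrite -Quotient.idealrBE subr0.
  by move/asboolP.
exact/asboolP.
Qed.

Lemma homology_piZ A B K (u : HomR A B) (v : HomR B K) a (z : kermod v) :
  a *: \pi_(homology u v)%qT z = \pi_(homology u v)%qT (a *: z).
Proof. exact: homology_scale_pi. Qed.

(** The homology of u followed by the zero map is the cokernel of u, so the quotient structure of
    [homology] is reused. *)
Lemma cokernel M N (u : HomR M N) :
  exists (Q : lmodType R) (q : HomR N Q),
    onto q /\ forall y, q y = 0 <-> exists x, u x = y.
Proof.
pose z : HomR N N := \0.
have kz y : y \in ker_pred z by rewrite inE.
pose f y : homology u z := \pi_(homology u z)%qT (Ker (kz y)).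
have lf : linear f.
  move=> a x y; rewrite /f homology_piZ -pi_addr; congr (\pi_ _ _)%qT.
  exact: val_inj.
exists (homology u z), (mkHom lf); split=> [t|y].
  have [[y yz] ->] := homology_pi t; exists y; rewrite [LHS]/(f y) /f.
  by congr (\pi_ _ _)%qT; apply: val_inj.
exact: homology_pi0.
Qed.

(** The fibre product is the kernel of p - p' on B x B'; its projections to B and B' inherit the
    kernels of p' and p. This serves all Schanuel-type comparisons. *)
Lemma pullback A B B' (p : HomR B A) (p' : HomR B' A) K K' (i : HomR K B)
    (i' : HomR K' B') : ses i p -> ses i' p' ->
  exists (P : lmodType R) (q : HomR P B) (q' : HomR P B') (k : HomR K P)
         (k' : HomR K' P),
  [/\ ses k q', ses k' q, forall x, p (q x) = p' (q' x),
      forall x, q (k x) = i x & forall x, q' (k' x) = i' x].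
Proof.
move=> [i_inj p_surj ip] [i'_inj p'_surj ip'].
have lf : linear (fun x : B * B' => p x.1 - p' x.2).
  by move=> a [x x'] [y y'] /=; rewrite !linearP scalerDr addrACA.
pose f : HomR _ _ := mkHom lf.
have fE x : (x \in ker_pred f) = (p x.1 == p' x.2) by rewrite inE /= subr_eq0.
have lq : linear (fun x : kermod f => (val x).1) by move=> a [[x y] ?] [[x' y'] ?].
have lq' : linear (fun x : kermod f => (val x).2) by move=> a [[x y] ?] [[x' y'] ?].
have kk x : (i x, 0) \in ker_pred f.
  by rewrite fE /= linear0; apply/eqP/ip; exists x.
have kk' x : (0, i' x) \in ker_pred f.
  by rewrite fE /= linear0 eq_sym; apply/eqP/ip'; exists x.
have lk : linear (fun x => Ker (kk x) : kermod f).
  by move=> a x y; apply: val_inj; congr (_, _); rewrite /= ?linearP //= scaler0 addr0.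
have lk' : linear (fun x => Ker (kk' x) : kermod f).
  by move=> a x y; apply: val_inj; congr (_, _); rewrite /= ?linearP //= scaler0 addr0.
exists (kermod f), (mkHom lq), (mkHom lq'), (mkHom lk), (mkHom lk').
split=> //.
- split=> [x y [/i_inj]|y|[[x y] /= xy]] //.
    have [x pxy] := p_surj (p' y).
    have xy : (x, y) \in ker_pred f by rewrite fE /= pxy.
    by exists (Ker xy).
  split=> /= [y0|[k /(congr1 val) [_ <-]] //].
  have /ip[k kx] : p x = 0 by move: (xy) => {xy}; rewrite fE /= y0 linear0 => /eqP.
  by exists k; apply: val_inj; rewrite /= kx y0.
- split=> [x y [/i'_inj]|x|[[x y] /= xy]] //.
    have [y pxy] := p'_surj (p x).
    have xy : (x, y) \in ker_pred f by rewrite fE /= pxy.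
    by exists (Ker xy).
  split=> /= [x0|[k /(congr1 val) [<- _]] //].
  have /ip'[k kx] : p' y = 0.
    by move: (xy) => {xy}; rewrite fE /= x0 linear0 eq_sym => /eqP.
  by exists k; apply: val_inj; rewrite /= kx x0.
- by move=> [[x y] xy]; apply/eqP; rewrite -fE.
Qed.

Definition projective (Q : lmodType R) :=
  forall A B (p : HomR B A) (f : HomR Q A), onto p ->
    exists g : HomR Q B, forall x, p (g x) = f x.

Lemma free_projective (X : choiceType) : projective (freemod R X).
Proof.
move=> A B p f p_surj.
pose e (x y : X) : R^o := (y == x)%:R.
have eF x : e x \in @finsupp_pred R X.
  apply/asboolP; apply: (sub_finite_set (B := [set x]%classic)) => // y /=.
  by rewrite /e; case: (eqVneq y x) => // _; rewrite eqxx.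
pose b x : freemod R X := Free (eF x).
have [phi phiP] : {phi : X -> B | forall x, p (phi x) = f (b x)}.
  exists (fun x => projT1 (cid (p_surj (f (b x))))) => x.
  exact: projT2 (cid (p_surj (f (b x)))).
have supp (z : freemod R X) :
    exists2 D : seq X, uniq D & forall x, x \notin D -> free_val z x = 0.
  have [D zD] : exists D : seq X, forall x, free_val z x != 0 -> x \in D.
    case: z => z /= /asboolP /finite_seqP[D zD]; exists D => x zx.
    by have : [set x | z x != 0]%classic x by []; rewrite zD.
  exists (undup D) => [|x]; first exact: undup_uniq.
  rewrite mem_undup => xD; apply/eqP; apply: contraNT xD; exact: zD.
pose r (z : freemod R X) (y : B) := exists D : seq X,
  [/\ uniq D, forall x, x \notin D -> free_val z x = 0 &
      y = \sum_(x <- D) free_val z x *: phi x].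
have widen (z : freemod R X) (D D' : seq X) (F : X -> B) :
    uniq D -> uniq D' -> {subset D <= D'} ->
    (forall x, x \notin D -> free_val z x = 0) ->
    \sum_(x <- D) free_val z x *: F x = \sum_(x <- D') free_val z x *: F x.
  move=> Du D'u DD' zD; rewrite [RHS](bigID (mem D)) /= [X in _ + X]big1 ?addr0.
    rewrite -[RHS]big_filter; apply: perm_big; apply: uniq_perm => //.
      exact: filter_uniq.
    by move=> x; rewrite mem_filter /= andb_idr //; exact: DD'.
  by move=> x /zD->; rewrite scale0r.
have [||y [D [_ _ ->]]|g gP] := @rel_hom _ _ r.
- move=> z; have [D Du zD] := supp z.
  by exists (\sum_(x <- D) free_val z x *: phi x); exists D.
- move=> a z y z' y' [D [Du zD ->]] [D' [D'u zD' ->]].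
  exists (undup (D ++ D')); split; first exact: undup_uniq.
    move=> x; rewrite mem_undup mem_cat negb_or => /andP[xD xD'].
    by rewrite /= !fctE zD // zD' // scaler0 addr0.
  rewrite (widen z D (undup (D ++ D'))) ?undup_uniq //; last first.
    by move=> x xD; rewrite mem_undup mem_cat xD.
  rewrite (widen z' D' (undup (D ++ D'))) ?undup_uniq //; last first.
    by move=> x xD; rewrite mem_undup mem_cat xD orbT.
  rewrite scaler_sumr -big_split /=; apply: eq_bigr => x _.
  by rewrite scalerDl scalerA.
- by apply: big1 => x _; rewrite scale0r.
exists g => z; have [D [Du zD ->]] := gP z.
rewrite linear_sum.
have {2}-> : z = \sum_(x <- D) (free_val z x : R) *: b x.
  pose v : HomR (freemod R X) (X -> R^o) := (val : freemod R X -> X -> R^o).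
  apply: val_inj; rewrite -[RHS]/(v _) linear_sum.
  apply/funext => x; rewrite fct_sumE -[LHS]/(free_val z x).
  have [xD|xD] := boolP (x \in D); last first.
    rewrite zD // big_seq big1 // => y yD; rewrite /= !fctE /e.
    case: eqVneq => [xy|_]; last by rewrite scaler0.
    by rewrite xy yD in xD.
  rewrite (bigD1_seq x) //= !fctE /e eqxx big1 ?addr0; last first.
    by move=> y yx; rewrite /= !fctE eq_sym (negPf yx) scaler0.
  by rewrite /GRing.scale /= mulr1.
by rewrite linear_sum; apply: eq_bigr => x _; rewrite !linearZ /= phiP.
Qed.

End LinearMaps.

(** * Annihilators of Ext and their behaviour in short exact sequences *)

Section Annihilation.
Variable R : comPzRingType.
Implicit Types (a b : R) (A B K P Q N : lmodType R).

Definition hcomp A B N (g : HomR B N) (f : HomR A B) : HomR A N := g \o f.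

Lemma hcompE A B N (g : HomR B N) (f : HomR A B) x : hcomp g f x = g (f x).
Proof. by []. Qed.

Lemma hom_subE A N (f g : HomR A N) x : (f - g) x = f x - g x.
Proof. by []. Qed.

Lemma hom_scaleE A N a (f : HomR A N) x : (a *: f) x = a *: f x.
Proof. by []. Qed.

Lemma aug_projective A : projective (freemod R A).
Proof. exact: free_projective. Qed.

Lemma ses_aug A : ses (ker_incl (aug A)) (aug A).
Proof. by apply: ses_ker => x; exact: aug_surj. Qed.

Lemma ses0 K B A (i : HomR K B) (p : HomR B A) x : ses i p -> p (i x) = 0.
Proof. by case=> _ _ ip; apply/ip; exists x. Qed.

Lemma ses_preimage A' A A'' S F (i : HomR A' A) (p : HomR A A'') (j : HomR S F)
    (q : HomR F A) : ses i p -> ses j q ->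
  exists (T : lmodType R) (k : HomR S T) (c : HomR T A') (e : HomR T F),
    [/\ ses k c, ses e (hcomp p q) & forall x, e (k x) = j x].
Proof.
move=> ip jq; have [i_inj p_surj i_p] := ip; have [j_inj q_surj j_q] := jq.
have pq_surj : onto (hcomp p q).
  by move=> y; have [x <-] := p_surj y; have [z <-] := q_surj x; exists z.
have e_ses := ses_ker pq_surj; have [e_inj _ e_pq] := e_ses.
have [|k kP] := @hom_lift_inj R _ _ _ (ker_incl (hcomp p q)) j e_inj.
  by move=> x; apply/e_pq; rewrite ?hcompE (ses0 x jq) linear0.
have [|c cP] := @hom_lift_inj R _ _ _ i (hcomp q (ker_incl (hcomp p q))) i_inj.
  by move=> x; apply/i_p; exact: (ses0 x e_ses).
exists (kermod (hcomp p q)), k, c, (ker_incl (hcomp p q)); split=> //.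
split=> [x y kxy|x|y]; first by apply: j_inj; rewrite -!kP kxy.
  have [y yx] := q_surj (i x).
  have [|z zy] := (e_pq y).1; first by rewrite ?hcompE yx (ses0 x ip).
  by exists z; apply: i_inj; rewrite cP ?hcompE zy.
split=> [cy|[x <-]].
  have [|x xy] := (j_q (ker_incl _ y)).1; first by rewrite -[q _]cP cy linear0.
  by exists x; apply: e_inj; rewrite kP.
by apply: i_inj; rewrite cP ?hcompE kP (ses0 x jq) linear0.
Qed.

Lemma split_ses K P Q (s : HomR K P) (p : HomR P Q) :
    ses s p -> projective Q ->
  exists (t : HomR Q P) (r : HomR P K), ses t r /\ forall x, r (s x) = x.
Proof.
move=> sp projQ; have [s_inj p_surj s_p] := sp.
have [t tP] := projQ _ _ p (idfun : HomR Q Q) p_surj.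
have [|r rP] := @hom_lift_inj R _ _ _ s (idfun - hcomp t p : HomR P P) s_inj.
  by move=> x; apply/s_p; rewrite hom_subE /= linearB tP subrr.
have rs x : r (s x) = x.
  by apply: s_inj; rewrite rP hom_subE /= (ses0 x sp) linear0 subr0.
exists t, r; split=> //; split=> [|x|y].
- by move=> x y txy; rewrite -[x]tP txy tP.
- by exists (s x).
split=> [ry|[x <-]].
  by exists (p y); apply/eqP; rewrite eq_sym -subr_eq0 -[_ - _]rP ry linear0.
by apply: s_inj; rewrite rP hom_subE /= tP subrr linear0.
Qed.

(* [Ext_kill N a l A] says that a annihilates Ext^(l+1)(A, N). *)
Fixpoint Ext_kill N a l A : Prop :=
  if l is m.+1 then Ext_kill N a m (kermod (aug A)) else
  forall h : HomR (kermod (aug A)) N, exists g : HomR (freemod R A) N,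
    forall x, g (ker_incl (aug A) x) = a *: h x.

Variable N : lmodType R.

(** A lift u of the free cover of A to B presents B as a quotient of the sum of the cover and K. The
    map g on the cover and a h on K agree on the relations, hence glue. *)
Lemma Ext_kill_ext a A K B (i : HomR K B) (p : HomR B A) :
    Ext_kill N a 0 A -> ses i p -> forall h : HomR K N,
  exists g : HomR B N, forall x, g (i x) = a *: h x.
Proof.
move=> kA ip h; have [i_inj p_surj i_p] := ip.
have [u uP] := aug_projective (aug A) p_surj.
have [|v vP] := @hom_lift_inj R _ _ _ i (hcomp u (ker_incl (aug A))) i_inj.
  by move=> x; apply/i_p; rewrite ?hcompE uP; exact: ses0 (ses_aug A).
have [g gP] := kA (hcomp h v).
have [|c z y z' y' [x [k [-> ->]]] [x' [k' [-> ->]]]|y [x [k [xk ->]]]|f fP] :=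
  @rel_hom R B N (fun z y => exists x k, z = u x + i k /\ y = g x + a *: h k).
- move=> z; have [x xz] := aug_surj (p z).
  have [|k kP] := (i_p (z - u x)).1; first by rewrite linearB uP xz subrr.
  by exists (g x + a *: h k), x, k; rewrite kP addrC subrK.
- exists (c *: x + x'), (c *: k + k'); split.
    by rewrite !linearP scalerDr addrACA.
  by rewrite (linearP g) (linearP h) !scalerDr !scalerA [c * a]mulrC addrACA.
- have [_ _ augK] := ses_aug A.
  have [|s sx] := (augK x).1.
    by rewrite -uP -[u x](addrK (i k)) -xk sub0r linearN (ses0 k ip) oppr0.
  have -> : k = - v s.
    apply: i_inj; apply/eqP; rewrite linearN vP ?hcompE sx.
    by rewrite -addr_eq0 addrC -xk.
  by rewrite -sx gP /= linearN scalerN addrN.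
exists f => k; have [x [k' [kx ->]]] := fP (i k).
have [_ _ augK] := ses_aug A.
have [|s sx] := (augK x).1.
  have /(congr1 p) := kx; rewrite linearD (ses0 k ip) uP (ses0 k' ip) addr0.
  by move->.
have -> : k = v s + k' by apply: i_inj; rewrite kx linearD vP -sx.
by rewrite -sx gP ?hcompE linearD scalerDr.
Qed.

Definition factors_proj a A := exists (Q : lmodType R) (u : HomR A Q) (t : HomR Q A),
  projective Q /\ forall x, t (u x) = a *: x.

(** If w lifts t to the free cover, the endomorphism a - w u aug of the cover lands in the syzygy
    and is multiplication by a there. So the factorisation through a projective passes to
    syzygies. *)
Lemma factors_proj_syzygy a A : factors_proj a A ->
  exists v : HomR (freemod R A) (kermod (aug A)),
    forall x, v (ker_incl (aug A) x) = a *: x.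
Proof.
move=> [Q [u [t [projQ tu]]]]; have [i_inj p_onto i_p] := ses_aug A.
have [w wP] := projQ _ _ (aug A) t p_onto.
pose f : HomR (freemod R A) (freemod R A) :=
  a *: idfun - hcomp w (hcomp u (aug A)).
have [x|v vP] := hom_lift_inj (f := f) i_inj.
  apply/i_p; rewrite hom_subE hom_scaleE /= linearB wP tu linearZ.
  by rewrite /= subrr.
exists v => x; apply: i_inj; rewrite vP hom_subE hom_scaleE ?hcompE.
by rewrite (ses0 x (ses_aug A)) !linear0 addr0 linearZ.
Qed.

Lemma Ext_kill_factors a l A : factors_proj a A -> Ext_kill N a l A.
Proof.
elim: l A => [|l IHl] A /factors_proj_syzygy[v vP] /=.
  by move=> h; exists (hcomp h v) => x; rewrite hcompE vP linearZ.
apply: IHl; exists (freemod R A), (ker_incl (aug A)), v.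
by split=> //; exact: aug_projective.
Qed.

Lemma Ext_kill_projective l Q : projective Q -> Ext_kill N 1 l Q.
Proof.
move=> projQ; apply: Ext_kill_factors; exists Q, idfun, idfun; split=> // x.
by rewrite scale1r.
Qed.

Lemma Ext_kill_torsion a l A : (forall x : A, a *: x = 0) -> Ext_kill N a l A.
Proof.
move=> aA; apply: Ext_kill_factors; exists (freemod R A), \0, (aug A).
by split=> [|x]; [exact: aug_projective|rewrite /= linear0 aA].
Qed.

Lemma Ext_kill_zero l A : zero_module A -> Ext_kill N 1 l A.
Proof. by move=> A0; apply: Ext_kill_torsion => x; rewrite scale1r; exact: A0. Qed.

(** The annihilator form of exactness of Ext^(l+1)(A'', N) -> Ext^(l+1)(A, N) -> Ext^(l+1)(A', N) in
    the middle. *)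
Definition half_exact l := forall a b A' A A'' (i : HomR A' A) (p : HomR A A''),
  ses i p -> Ext_kill N a l A'' -> Ext_kill N b l A' -> Ext_kill N (a * b) l A.

(** The sequence splits, so Ext^(l+1)(K, N) is a summand of Ext^(l+1)(P, N). *)
Definition split_sub l := forall a K P Q (s : HomR K P) (p : HomR P Q),
  ses s p -> projective Q -> Ext_kill N a l P -> Ext_kill N a l K.

Lemma half_exact0 : half_exact 0.
Proof.
move=> a b A' A A'' i p ip kA'' kA' h.
have [T [k [c [e [kc epq ek]]]]] := ses_preimage ip (ses_aug A).
have [g gP] := Ext_kill_ext kA' kc h.
have [f fP] := Ext_kill_ext kA'' epq g.
by exists f => x; rewrite -ek fP gP scalerA.
Qed.

Lemma split_sub0 : split_sub 0.
Proof.
move=> a K P Q s p sp projQ kP h.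
have [_ [r [_ rs]]] := split_ses sp projQ.
have [jK_inj qK_surj jK_q] := ses_aug K.
have [jP_inj qP_surj jP_q] := ses_aug P.
have [w wP] := aug_projective (hcomp s (aug K)) qP_surj.
have [w' w'P] := aug_projective (hcomp r (aug P)) qK_surj.
have [|v vP] := @hom_lift_inj R _ _ _ (ker_incl (aug K))
  (hcomp w' (ker_incl (aug P))) jK_inj.
  by move=> x; apply/jK_q; rewrite ?hcompE w'P ?hcompE (ses0 x (ses_aug P)) linear0.
have [g gP] := kP (hcomp h v).
(* Both w' w and the identity of the cover lift the identity of K, so they differ by a map c into
   the syzygy, which corrects the extension. *)
have [|c cP] := @hom_lift_inj R _ _ _ (ker_incl (aug K))
  (hcomp w' w - idfun : HomR (freemod R K) (freemod R K)) jK_inj.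
  move=> x; apply/jK_q.
  by rewrite hom_subE linearB ?hcompE w'P ?hcompE wP ?hcompE rs subrr.
exists (hcomp g w - a *: hcomp h c) => x.
have [|y yx] := (jP_q (w (ker_incl _ x))).1.
  by rewrite wP ?hcompE (ses0 x (ses_aug K)) linear0.
rewrite hom_subE hom_scaleE ?hcompE -yx gP ?hcompE -scalerBr -linearB.
congr (_ *: h _); apply: jK_inj; rewrite linearB vP cP hom_subE ?hcompE yx.
by rewrite opprB addrC subrK.
Qed.

Section Level.
Variable l : nat.
Hypotheses (Hl : half_exact l) (Sl : split_sub l).

(** Schanuel's argument: the pullback of the two presentations is an extension of F' by K, and K' is
    a summand of it with complement F. *)
Lemma Ext_kill_indep a A K F K' F' (i : HomR K F) (p : HomR F A)
    (i' : HomR K' F') (p' : HomR F' A) :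
    ses i p -> ses i' p' -> projective F -> projective F' ->
  Ext_kill N a l K -> Ext_kill N a l K'.
Proof.
move=> ip ip' projF projF' kK.
have [P [q [q' [k [k' [kq' k'q _ _ _]]]]]] := pullback ip ip'.
apply: (Sl k'q) => //; rewrite -[a]mul1r.
by apply: (Hl kq') => //; exact: Ext_kill_projective.
Qed.

Lemma Ext_kill_presentation a A K F (i : HomR K F) (p : HomR F A) :
  ses i p -> projective F -> (Ext_kill N a l.+1 A <-> Ext_kill N a l K).
Proof.
move=> ip projF; split=> /= kA.
  exact: Ext_kill_indep (ses_aug A) ip (@aug_projective A) projF kA.
exact: Ext_kill_indep ip (ses_aug A) projF (@aug_projective A) kA.
Qed.

(** Pulling back the free cover of A'' to A gives an extension of A by the syzygy of A'', and A' is
    a summand of it. This stands in for the connecting map. *)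
Lemma Ext_kill_left_level a b A' A A'' (i : HomR A' A) (p : HomR A A'') :
  ses i p -> Ext_kill N a l A -> Ext_kill N b l.+1 A'' -> Ext_kill N (a * b) l A'.
Proof.
move=> ip kA kA''.
have [P [q [q' [k [k' [kq' k'q _ _ _]]]]]] := pullback ip (ses_aug A'').
by apply: (Sl kq'); [exact: aug_projective|exact: Hl k'q kA kA''].
Qed.

(** The preimage T of A' in the free cover of A is both a syzygy of A'' and an extension of A' by
    the syzygy of A. *)
Lemma Ext_kill_right_level a b A' A A'' (i : HomR A' A) (p : HomR A A'') :
  ses i p -> Ext_kill N a l A' -> Ext_kill N b l.+1 A -> Ext_kill N (a * b) l.+1 A''.
Proof.
move=> ip kA' kA.
have [T [k [c [e [kc epq _]]]]] := ses_preimage ip (ses_aug A).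
by apply/(Ext_kill_presentation _ epq); [exact: aug_projective|exact: Hl kc _ _].
Qed.

End Level.

(** At level l + 1 a split sequence is read backwards, 0 -> Q -> P -> K -> 0, and half exactness
    becomes a statement on the preimage of A' in the free cover of A; the connecting-map lemmas at
    level l give both. *)
Lemma half_exact_split_sub l : half_exact l /\ split_sub l.
Proof.
elim: l => [|l [Hl Sl]]; first by split; [exact: half_exact0|exact: split_sub0].
split; last first.
  move=> a K P Q s p sp projQ kP.
  have [t [r [tr _]]] := split_ses sp projQ.
  rewrite -[a]mul1r; apply: (Ext_kill_right_level Hl Sl tr) => //.
  exact: Ext_kill_projective.
move=> a b A' A A'' i p ip kA'' kA'.
have [T [k [c [e [kc epq _]]]]] := ses_preimage ip (ses_aug A).
apply: (Ext_kill_left_level Hl Sl kc) => //.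
by apply/(Ext_kill_presentation Hl Sl a epq); first exact: aug_projective.
Qed.

Lemma Ext_kill_left a b l A' A A'' (i : HomR A' A) (p : HomR A A'') :
  ses i p -> Ext_kill N a l A -> Ext_kill N b l.+1 A'' -> Ext_kill N (a * b) l A'.
Proof. by have [Hl Sl] := half_exact_split_sub l; exact: Ext_kill_left_level. Qed.

Lemma Ext_kill_right a b l A' A A'' (i : HomR A' A) (p : HomR A A'') :
  ses i p -> Ext_kill N a l A' -> Ext_kill N b l.+1 A -> Ext_kill N (a * b) l.+1 A''.
Proof. by have [Hl Sl] := half_exact_split_sub l; exact: Ext_kill_right_level. Qed.

End Annihilation.

(** * Ext with coefficients modulo a regular element *)

Section Coefficients.
Variable R : comPzRingType.
Implicit Types (r : R) (A B K N : lmodType R).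

Definition regular_on r N := forall x : N, r *: x = 0 -> x = 0.

Section Quotient.
Variables (N N' : lmodType R) (r : R) (q : HomR N N').
Hypothesis rq : ses (homothety N r) q.

Lemma ses_homothety_regular : regular_on r N.
Proof.
by have [r_inj _ _] := rq; move=> x rx; apply: r_inj; rewrite [LHS]rx linear0.
Qed.

Lemma ses_homothety_div A (f : HomR A N) :
  (forall x, q (f x) = 0) -> exists g : HomR A N, forall x, r *: g x = f x.
Proof.
have [r_inj _ r_q] := rq; move=> qf.
have [x|g gP] := hom_lift_inj (f := f) r_inj; first by apply/r_q.
by exists g.
Qed.

Lemma ses_homothety0 (x : N) : q (r *: x) = 0.
Proof. exact: (ses0 x rq). Qed.

(** A lift g of f to the free cover of A is divisible by r on the syzygy; extending the quotient h
    to the cover and subtracting r times it makes g descend to A. *)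
Lemma hom_lift_quotient A (f : HomR A N') :
  Ext_kill N 1 0 A -> exists g : HomR A N, forall x, q (g x) = f x.
Proof.
move=> kA; have [_ q_surj _] := rq; have [j_inj p_surj j_p] := ses_aug A.
have [g gP] := aug_projective (hcomp f (aug A)) q_surj.
have [x|h hP] := ses_homothety_div (f := hcomp g (ker_incl (aug A))).
  by rewrite hcompE gP hcompE (ses0 x (ses_aug A)) linear0.
have [h' h'P] := kA h.
have [|m mP] := hom_factor (f := g - r *: h') p_surj.
  move=> x /j_p[y <-]; rewrite hom_subE hom_scaleE h'P scale1r hP hcompE.
  by rewrite subrr.
exists m => x; have [y <-] := p_surj x.
by rewrite mP hom_subE hom_scaleE linearB ses_homothety0 subr0 gP.
Qed.

Lemma Ext_kill_quotient l A :
  Ext_kill N 1 l A -> Ext_kill N 1 l.+1 A -> Ext_kill N' 1 l A.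
Proof.
elim: l A => [|l IHl] A; last exact: IHl.
move=> kA kS h; have [g gP] := hom_lift_quotient h kS.
have [f fP] := kA g; exists (hcomp q f) => x.
by rewrite hcompE fP !scale1r gP.
Qed.

(** The kernel of r on Ext^1(A, N) is the image of Hom(A, N') = 0, so r acts on it both injectively
    and as zero. [Ext_kill_regular] is the same with Ext^(l+1)(A, N') in place of Hom(A, N'). *)
Lemma Ext_kill_regular0 A : Ext_kill N r 0 A ->
  (forall (f : HomR A N') x, f x = 0) -> Ext_kill N 1 0 A.
Proof.
move=> kA A0 h; have [_ p_surj j_p] := ses_aug A; have [g gP] := kA h.
have [|f fP] := hom_factor (f := hcomp q g) p_surj.
  by move=> x /j_p[y <-]; rewrite hcompE gP ses_homothety0.
have [x|m mP] := ses_homothety_div (f := g); first by rewrite -[LHS]fP A0.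
exists m => x; rewrite scale1r; apply/eqP; rewrite -subr_eq0; apply/eqP.
by apply: ses_homothety_regular; rewrite scalerBr mP gP subrr.
Qed.

Lemma Ext_kill_regular l A :
  Ext_kill N r l.+1 A -> Ext_kill N' 1 l A -> Ext_kill N 1 l.+1 A.
Proof.
elim: l A => [|l IHl] A; last exact: IHl.
move=> kS kA h; have [_ q_surj _] := rq.
have [_ p_surj j_p] := ses_aug (kermod (aug A)); have [g gP] := kS h.
have [|f fP] := hom_factor (f := hcomp q g) p_surj.
  by move=> x /j_p[y <-]; rewrite hcompE gP ses_homothety0.
have [f' f'P] := kA f.
have [m mP] := aug_projective f' q_surj.
have [x|g' g'P] := ses_homothety_div
    (f := g - hcomp m (hcomp (ker_incl (aug A)) (aug (kermod (aug A))))).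
  by rewrite hom_subE linearB !hcompE mP f'P scale1r fP subrr.
exists g' => x; rewrite scale1r; apply/eqP; rewrite -subr_eq0; apply/eqP.
apply: ses_homothety_regular; rewrite scalerBr g'P hom_subE gP !hcompE.
by rewrite (ses0 x (ses_aug _)) !linear0 addr0 subrr.
Qed.

End Quotient.

(** * Quotients of C by regular sequences *)

Section RegularQuotient.
Variable C : lmodType R.

(* [regular_quotient g N]: N is C / (r_1, ..., r_g) C for a C-regular sequence. *)
Inductive regular_quotient : nat -> lmodType R -> Prop :=
| regular_quotient0 : regular_quotient 0 C
| regular_quotientS g N N' r (q : HomR N N') :
    regular_quotient g N -> ses (homothety N r) q -> regular_quotient g.+1 N'.

(** Regularity is meant in the weak sense: rN may be all of N, the next quotient then being zero. *)
Lemma regular_quotient_next g N r : regular_quotient g N -> regular_on r N ->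
  exists N' (q : HomR N N'), ses (homothety N r) q /\ regular_quotient g.+1 N'.
Proof.
move=> CN rN; have [N' [q [q_surj r_q]]] := cokernel (homothety N r).
have rq : ses (homothety N r) q by split=> //; apply: inj_hom.
by exists N', q; split=> //; exact: regular_quotientS rq.
Qed.

Lemma regular_quotient_acyclic g N A : regular_quotient g N ->
  (forall l, Ext_kill C 1 l A) -> forall l, Ext_kill N 1 l A.
Proof.
move=> CN kA; elim: CN => // g' N1 N2 r q _ IH rq l.
exact: (Ext_kill_quotient rq).
Qed.

Definition hdual A B (u : HomR A B) : HomR (HomR B C) (HomR A C) :=
  Hom_pre (N := C) u.

Lemma hdualE A B (u : HomR A B) f x : hdual u f x = f (u x).
Proof. by []. Qed.

Variables (X : nat -> lmodType R) (d : forall k, HomR (X k.+1) (X k)).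
Hypothesis X_bidual : forall k, bijective (@biduality R C (X k)).
Hypothesis X_dual_acyclic : forall k l, Ext_kill C 1 l (HomR (X k) C).
Hypothesis d_exact : forall k x, d k x = 0 <-> exists x', d k.+1 x' = x.

(** For N = C the complex is X itself by biduality, hence exact. Each further regular element costs
    one degree, by the long exact sequence of 0 -> N -> N -> N' -> 0. *)
Lemma bidual_exact g N : regular_quotient g N -> forall k, (g <= k)%N ->
  forall z : HomR (HomR (X k.+1) C) N,
    (forall f, z (hdual (d k) f) = 0) ->
  exists u : HomR (HomR (X k.+2) C) N, forall f, z f = u (hdual (d k.+1) f).
Proof.
elim=> [k _|{N}g' N N' r q CN IH rq k gk] z zd.
  have [bd bdK Kbd] := X_bidual k.+1.
  have zE f : z f = f (bd z) by rewrite -{1}[z]Kbd.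
  have /d_exact[x' dx'] : d k (bd z) = 0.
    apply: (bij_inj (X_bidual k)); apply: Hom_eq => f.
    by rewrite -[LHS]/(hdual (d k) f (bd z)) -zE zd -[RHS]/(f 0) linear0.
  by exists (biduality C x') => f; rewrite -[RHS]/(f (d k.+1 x')) dx' zE.
case: k gk z zd => // k gk z zd.
have [t tz] := hom_lift_quotient rq z
  (regular_quotient_acyclic CN (X_dual_acyclic k.+2) 0).
(* Here w is the image of z under the connecting map. It is a cycle, hence comes from some v, and t
   - r v is then a cycle over N that still lifts z. *)
have [f|w wP] := ses_homothety_div rq (f := hcomp t (hdual (d k.+1))).
  by rewrite hcompE tz zd.
have [f|v vP] := IH k gk w.
  apply: (ses_homothety_regular rq); rewrite wP hcompE.
  have -> : hdual (d k.+1) (hdual (d k) f) = 0.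
    apply: Hom_eq => x; rewrite !hdualE.
    have -> : d k (d k.+1 x) = 0 by apply/d_exact; exists x.
    by rewrite linear0.
  by rewrite linear0.
have [f|u uP] := IH k.+1 (leqW gk) (t - r *: v).
  by rewrite hom_subE hom_scaleE -vP wP subrr.
exists (hcomp q u) => f.
by rewrite hcompE -uP hom_subE hom_scaleE linearB (ses_homothety0 rq) subr0 tz.
Qed.

End RegularQuotient.
End Coefficients.

(** * Finitely generated modules over a Noetherian ring *)

Section Noetherian.
Variable R : comPzRingType.
Implicit Types (a b c r : R) (A B K E N : lmodType R).

Fixpoint in_span N (s : seq N) (x : N) : Prop :=
  if s is y :: s' then exists a, in_span s' (x - a *: y) else x = 0.

Definition submod N (P : N -> Prop) :=
  P 0 /\ forall a x y, P x -> P y -> P (a *: x + y).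

Definition fg N (P : N -> Prop) :=
  exists s : seq N, (forall x, x \in s -> P x) /\ forall x, P x -> in_span s x.

Definition fgmod N := exists s : seq N, forall x, in_span s x.

Lemma submod_sub N (P : N -> Prop) x y : submod P -> P x -> P y -> P (x - y).
Proof. by case=> _ PD Px Py; rewrite addrC -scaleN1r; exact: PD. Qed.

Lemma in_span_submod N (s : seq N) : submod (in_span s).
Proof.
elim: s => [|y s [s0 sD]]; first by split=> //= a x y -> ->; rewrite scaler0 addr0.
split=> /= [|a x x' [b xb] [b' xb']]; first by exists 0; rewrite scale0r subr0.
exists (a * b + b'); have := sD a _ _ xb xb'.
by rewrite scalerBr scalerA addrACA -opprD -scalerDl.
Qed.

Lemma in_span_least N (s : seq N) (P : N -> Prop) x :
  submod P -> (forall y, y \in s -> P y) -> in_span s x -> P x.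
Proof.
move=> [P0 PD]; elim: s x => [|y s IH] x sP /=; first by move->.
move=> [a xa]; rewrite -[x](subrK (a *: y)) addrC; apply: PD.
  by apply: sP; rewrite mem_head.
by apply: IH => // z zs; apply: sP; rewrite in_cons zs orbT.
Qed.

Lemma mem_in_span N (s : seq N) x : x \in s -> in_span s x.
Proof.
elim: s => //= y s IH; rewrite in_cons => /orP[/eqP->|/IH xs].
  by exists 1; rewrite scale1r subrr; case: (in_span_submod s).
by exists 0; rewrite scale0r subr0.
Qed.

Lemma in_span_cat N (s t : seq N) x y :
  in_span s x -> in_span t y -> in_span (s ++ t) (x + y).
Proof.
move=> xs yt; have [_ D] := in_span_submod (s ++ t).
rewrite -[x]scale1r; apply: D.
  apply: in_span_least xs => [|z zs]; first exact: in_span_submod.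
  by apply: mem_in_span; rewrite mem_cat zs.
apply: in_span_least yt => [|z zs]; first exact: in_span_submod.
by apply: mem_in_span; rewrite mem_cat zs orbT.
Qed.

Lemma in_span_map A N (f : HomR A N) s x : in_span s x -> in_span (map f s) (f x).
Proof.
elim: s x => [|y s IH] x /=; first by move->; rewrite linear0.
by move=> [a /IH]; rewrite linearB linearZ /=; exists a.
Qed.

Lemma in_span_sum N (I : Type) (s : seq I) (c : I -> R) (g : I -> N) :
  in_span (map g s) (\sum_(i <- s) c i *: g i).
Proof.
elim: s => [|i s IH] /=; first by rewrite big_nil.
by rewrite big_cons; exists (c i); rewrite addrAC subrr add0r.
Qed.

Lemma finite_fgmod N : finite_module N -> fgmod N.
Proof.
move=> [n [g gP]]; exists [seq g i | i <- index_enum 'I_n] => x.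
by have [c ->] := gP x; exact: in_span_sum.
Qed.

Lemma fgmod_quotient A N (q : HomR A N) : onto q -> fgmod A -> fgmod N.
Proof.
move=> q_surj [s sP]; exists (map q s) => y; have [x <-] := q_surj y.
exact: in_span_map.
Qed.

Hypothesis noethR : noetherian R.

Lemma ideal_fg (P : R^o -> Prop) : submod P -> fg P.
Proof.
move=> [P0 PD]; have [|n [g gP]] := noethR (I := [pred x | `[<P x>]]).
  split=> [|a x y]; rewrite !inE; first exact: P0.
  exact: PD.
exists [seq (g i : R^o) | i <- index_enum 'I_n]; split=> [_ /mapP[i _ ->]|x Px].
  suff /asboolP : g i \in [pred x | `[<P x>]] by [].
  apply/gP; exists (fun j => (j == i)%:R).
  rewrite (bigD1 i) //= eqxx mul1r big1 ?addr0 // => j /negPf->.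
  by rewrite mul0r.
have [c ->] := (gP x).1 (asboolT Px).
exact: (@in_span_sum R^o).
Qed.

Lemma noetherian_module N (P : N -> Prop) : fgmod N -> submod P -> fg P.
Proof.
move=> [s sN] subP; have {sN} : forall x, P x -> in_span s x by [].
elim: s P subP => [|y s IH] P subP sP; first by exists [::]; split.
have [P0 PD] := subP; have [s0 sD] := in_span_submod s.
(* J is the ideal of leading coefficients at y of elements of P. Lifts of its generators, with
   generators of the part of P inside the span of s, generate P. *)
pose J (a : R^o) := exists2 x, P x & in_span s (x - (a : R) *: y).
have subJ : submod J.
  split; first by exists 0; rewrite // scale0r subr0.
  move=> a b c [x Px xb] [x' Px' xc]; exists (a *: x + x'); first exact: PD.
  have := sD a _ _ xb xc.
  by rewrite scalerBr scalerA addrACA -opprD -scalerDl.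
have [as_ [asJ Jas]] := ideal_fg subJ.
have [||t [tP Pt]] := IH (fun x => P x /\ in_span s x).
- by split=> // a x x' [Px sx] [Px' sx']; split; [exact: PD|exact: sD].
- by move=> x [].
have [u uP uJ] : exists2 u : seq N, forall x, x \in u -> P x &
    forall a : R^o, in_span as_ a ->
      exists2 x, in_span u x & in_span s (x - (a : R) *: y).
  elim: as_ asJ {Jas} => [|b as_ IHas] asJ.
    by exists [::] => // a /= ->; exists 0; rewrite // scale0r subr0.
  have [|u uP uJ] := IHas.
    by move=> c cas; apply: asJ; rewrite in_cons cas orbT.
  have [z Pz zb] := asJ b (mem_head _ _).
  exists (z :: u) => [x|a /= [c /uJ[x xu xs]]].
    by rewrite in_cons => /orP[/eqP->|/uP].
  exists (c *: z + x); first by exists c; rewrite addrC addrA addNr add0r.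
  have := sD c _ _ zb xs.
  rewrite scalerBr scalerA addrACA -opprD -scalerDl.
  by have -> : c * b + (a - c *: b) = a by rewrite addrC subrK.
exists (u ++ t); split=> [x|x Px].
  by rewrite mem_cat => /orP[/uP|/tP[]].
have [a xa] := sP x Px.
have [|z zu za] := uJ a; first by apply: Jas; exists x.
rewrite -[x](subrK z) addrC; apply: in_span_cat => //; apply: Pt; split.
  by apply: submod_sub => //; exact: in_span_least zu.
have := submod_sub (in_span_submod s) xa za.
by rewrite opprB addrA subrK.
Qed.

Lemma fgmod_ker A N (p : HomR A N) : fgmod N -> fgmod (kermod p) -> fgmod A.
Proof.
move=> fgN [k kK].
have [|t [tP Pt]] :=
    noetherian_module (P := fun y => exists x, p x = y) fgN.
  split; first by exists 0; rewrite linear0.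
  by move=> a _ _ [x <-] [y <-]; exists (a *: x + y); rewrite linearP.
have [s st] : exists s, t = map p s.
  elim: t tP {Pt} => [|y t IH] tP; first by exists [::].
  have [|s ->] := IH; first by move=> z zt; apply: tP; rewrite in_cons zt orbT.
  by have [x <-] := tP y (mem_head _ _); exists (x :: s).
exists (s ++ map (ker_incl p) k) => x.
have [y ys yx] : exists2 y, in_span s y & p y = p x.
  have : in_span (map p s) (p x) by rewrite -st; apply: Pt; exists x.
  elim: s {t tP Pt st} x => [|z s IH] x /=; first by exists 0; rewrite ?linear0.
  move=> [a]; rewrite -linearZ -linearB => /IH[y ys yx].
  by exists (y + a *: z); [exists a; rewrite addrK|rewrite linearD yx linearB subrK].
rewrite -[x](subrK y) addrC; apply: in_span_cat => //.
have xy : x - y \in ker_pred p by rewrite inE linearB yx subrr.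
exact: in_span_map (kK (Ker xy)).
Qed.

(** Evaluation at a generator maps into N, and its kernel has one generator fewer to test. Stating
    this for any B embedded in Hom(A, N) lets the induction run. *)
Lemma fgmod_hom A N : fgmod A -> fgmod N -> fgmod (HomR A N).
Proof.
move=> [s sA] fgN.
suff gen B (f : HomR B (HomR A N)) :
    (forall z, (forall x, x \in s -> f z x = 0) -> z = 0) -> fgmod B.
  apply: (gen _ idfun) => g g0; apply: Hom_eq => x.
  apply: (in_span_least (P := fun x => g x = 0)) (sA x) => //.
  by split=> [|a y z gy gz]; rewrite ?linear0 // linearP gy gz scaler0 addr0.
elim: s {sA} B f => [|x s IH] B f fs.
  by exists [::] => b; exact: fs.
have lp : linear (fun z => f z x) by move=> a b c; rewrite linearP.
apply: (@fgmod_ker _ _ (mkHom lp)) => //.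
apply: (IH _ (hcomp f (ker_incl (mkHom lp)))) => b b0.
apply: val_inj; apply: fs => y; rewrite in_cons => /orP[/eqP->|/b0 //].
by apply/eqP; exact: (valP b).
Qed.

(** * Associated primes and regular elements *)

Section MaximalAnnihilators.
Variable N : lmodType R.
Hypothesis fgN : fgmod N.
Implicit Types m n : N.

Definition sub_ann m n := forall a, a *: m = 0 -> a *: n = 0.

(** Such annihilators are associated primes of N ([max_ann_prime]); the elements n stand for the
    primes, so that no prime ideal has to be formed. *)
Definition max_ann n :=
  n <> 0 /\ forall m, m <> 0 -> sub_ann n m -> sub_ann m n.

(** Otherwise there is a strictly increasing chain of annihilators; its union is an ideal, whose
    finitely many generators lie in one member. *)
Lemma max_ann_exists m : m <> 0 -> exists2 n, max_ann n & sub_ann m n.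
Proof.
move=> m0; apply: contrapT => no_max.
pose T := {n : N | n <> 0 /\ sub_ann m n}.
have next (x : T) : {y : T | sub_ann (sval x) (sval y) /\ ~ sub_ann (sval y) (sval x)}.
  apply: cid; apply: contrapT => no_next; case: x no_next => n [n0 mn] no_next.
  apply: no_max; exists n => //; split=> // n' n'0 nn'.
  apply: contrapT => n'n; apply: no_next.
  have mn' : sub_ann m n' by move=> a /mn/nn'.
  by exists (exist _ n' (conj n'0 mn')).
have m_T : m <> 0 /\ sub_ann m m by split=> // a.
pose u k := iter k (fun x => sval (next x)) (exist _ m m_T : T).
have u_incr k l : (k <= l)%N -> sub_ann (sval (u k)) (sval (u l)).
  elim: l => [|l IH]; first by rewrite leqn0 => /eqP->.
  rewrite leq_eqVlt ltnS => /orP[/eqP->//|/IH kl] a /kl.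
  by have [+ _] := svalP (next (u l)); apply.
pose J (a : R^o) := exists k, (a : R) *: sval (u k) = 0.
have subJ : submod J.
  split=> [|a b c [k bk] [l cl]]; first by exists 0; rewrite scale0r.
  exists (maxn k l); rewrite scalerDl -scalerA.
  rewrite (u_incr k _ (leq_maxl _ _) b bk) (u_incr l _ (leq_maxr _ _) c cl).
  by rewrite scaler0 addr0.
have [s [sJ Js]] := ideal_fg subJ.
have [k ks] : exists k, forall a, a \in s -> (a : R) *: sval (u k) = 0.
  elim: s sJ {Js} => [|a s IH] sJ; first by exists 0.
  have [|k ks] := IH; first by move=> b bs; apply: sJ; rewrite in_cons bs orbT.
  have [l al] := sJ a (mem_head _ _); exists (maxn k l) => b.
  rewrite in_cons => /orP[/eqP->|/ks bk]; first by apply: u_incr al; rewrite leq_maxr.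
  by apply: u_incr bk; rewrite leq_maxl.
have [_ []] := svalP (next (u k)).
move=> a au; have {}au : J a by exists k.+1.
apply: (in_span_least (P := fun a : R^o => (a : R) *: sval (u k) = 0)) (Js a au) => //.
split=> [|b c d ck dk]; first by rewrite scale0r.
by rewrite scalerDl -scalerA ck dk scaler0 addr0.
Qed.

Lemma max_ann_prime n a b : max_ann n -> a *: (b *: n) = 0 -> b *: n <> 0 -> a *: n = 0.
Proof.
move=> [n0 nmax] abn bn; apply: (nmax (b *: n)) => // c cn.
by rewrite scalerA mulrC -scalerA cn scaler0.
Qed.

Lemma max_ann_avoid n (s : seq N) : max_ann n ->
    (forall m, m \in s -> exists c, c *: m = 0 /\ c *: n <> 0) ->
  exists c, (forall m, m \in s -> c *: m = 0) /\ c *: n <> 0.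
Proof.
move=> maxn; elim: s => [|m s IH] sP.
  by exists 1; split=> //; rewrite scale1r; case: maxn.
have [|c [cs cn]] := IH; first by move=> x xs; apply: sP; rewrite in_cons xs orbT.
have [b [bm bn]] := sP m (mem_head _ _); exists (b * c); split=> [x|bcn].
  rewrite in_cons => /orP[/eqP->|/cs cx]; last by rewrite -scalerA cx scaler0.
  by rewrite mulrC -scalerA bm scaler0.
by apply: bn; apply: max_ann_prime cn => //; rewrite scalerA.
Qed.

(** The elements with maximal annihilator span a submodule generated by finitely many of them. What
    kills these kills every such n, so by primality the annihilator of n contains, and then equals,
    one of theirs. *)
Lemma finite_max_ann : exists s : seq N, (forall n, n \in s -> max_ann n) /\
  forall n, max_ann n -> exists2 m, m \in s & sub_ann n m.
Proof.
pose P (x : N) := exists s : seq N, (forall n, n \in s -> max_ann n) /\ in_span s x.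
have subP : submod P.
  split; first by exists [::].
  move=> a x y [s [sm sx]] [t [tm ty]]; exists (s ++ t); split.
    by move=> n; rewrite mem_cat => /orP[/sm|/tm].
  apply: in_span_cat => //; rewrite -[a *: x]addr0.
  by have [s0 sD] := in_span_submod s; exact: sD.
have [t [tP Pt]] := noetherian_module fgN subP.
have [s [sm ts]] : exists s : seq N, (forall n, n \in s -> max_ann n) /\
    forall x, x \in t -> in_span s x.
  elim: t tP {Pt} => [|x t IH] tP; first by exists [::].
  have [|s [sm st]] := IH; first by move=> y yt; apply: tP; rewrite in_cons yt orbT.
  have [s' [s'm s'x]] := tP x (mem_head _ _); exists (s' ++ s); split.
    by move=> n; rewrite mem_cat => /orP[/s'm|/sm].
  have [s0 _] := in_span_submod s; have [s'0 _] := in_span_submod s'.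
  move=> y; rewrite in_cons => /orP[/eqP->|/st sy].
    by rewrite -[x]addr0; exact: in_span_cat.
  by rewrite -[y]add0r; exact: in_span_cat.
exists s; split=> // n nmax; apply: contrapT => no_m.
have [|c [cs cn]] := max_ann_avoid (s := s) nmax.
  move=> m ms; have [m0 mmax] := sm m ms; have [n0 _] := nmax.
  apply: contrapT => no_c; apply: no_m; exists m => //; apply: mmax => // c cm.
  by apply: contrapT => cn; apply: no_c; exists c.
apply: cn; have sn : in_span s n.
  apply: in_span_least (Pt n _) => //; first exact: in_span_submod.
  exists [:: n]; split; last by apply: mem_in_span; rewrite mem_head.
  by move=> m; rewrite inE => /eqP->.
apply: (in_span_least (P := fun x => c *: x = 0)) sn => //.
split=> [|a x y cx cy]; first by rewrite scaler0.
by rewrite scalerDr cy addr0 scalerA mulrC -scalerA cx scaler0.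
Qed.

(* Prime avoidance for the finitely many maximal annihilators of elements of N. *)
Lemma regular_in_ideal (J : R^o -> Prop) : submod J ->
    (forall n, (forall a : R, J a -> a *: n = 0) -> n = 0) ->
  exists2 r, J r & regular_on r N.
Proof.
move=> [J0 JD] JN; have [s [sm ms]] := finite_max_ann.
have [r Jr rs] : exists2 r : R, J r & forall n, n \in s -> r *: n <> 0.
  elim: s sm {ms} => [|m s IH] sm; first by exists 0.
  have [|r Jr rs] := IH; first by move=> n ns; apply: sm; rewrite in_cons ns orbT.
  have mm := sm m (mem_head _ _).
  have [rm|rm] := pselect (r *: m = 0); last first.
    by exists r => // n; rewrite in_cons => /orP[/eqP->|/rs].
  have [|c [cs cm]] := max_ann_avoid (s := s) mm.
    move=> n ns; have [n0 nmax] : max_ann n by apply: sm; rewrite in_cons ns orbT.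
    apply: contrapT => no_c; apply: (rs n ns); apply: (nmax m) => //.
      by case: mm.
    by move=> c cn; apply: contrapT => cm; apply: no_c; exists c.
  have [j Jj jm] : exists2 j, J j & j *: m <> 0.
    apply: contrapT => no_j; case: mm => + _; apply; apply: JN => a Ja.
    by apply: contrapT => am; apply: no_j; exists a.
  (* Since c kills the elements of s, adding c j leaves the action of r on them unchanged; on m, r
     is zero and c j is not, by primality. *)
  exists (c * j + r) => [|n]; first exact: JD.
  rewrite in_cons => /orP[/eqP->|ns].
    rewrite scalerDl rm addr0 -scalerA => cjm; apply: cm.
    exact: max_ann_prime jm.
  by rewrite scalerDl mulrC -scalerA cs // scaler0 add0r; exact: rs.
exists r => // n rn; apply: contrapT => n0.
have [n' n'm nn'] := max_ann_exists n0; have [m m_s n'm'] := ms n' n'm.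
by apply: (rs m m_s); apply: n'm'; exact: nn'.
Qed.

Lemma regular_mul r r' : regular_on r N -> regular_on r' N -> regular_on (r * r') N.
Proof. by move=> rN r'N x; rewrite -scalerA => /rN/r'N. Qed.

(** Modulo one generator e, induction gives a regular r with rE inside Re. If the annihilator of e
    kills n, sending x to b n, where r x = b e, is a well defined map E -> N, hence zero, so r n = 0
    and n = 0. By [regular_in_ideal] the annihilator of e thus contains a regular r', and r' r kills
    E. *)
Lemma regular_annihilator E : fgmod E ->
    (forall (f : HomR E N) x, f x = 0) ->
  exists2 r, regular_on r N & forall x : E, r *: x = 0.
Proof.
move=> [s]; have [k] := ubnP (size s).
elim: k E s => // k IH E [_ sE _|e s].
  by exists 1 => x; rewrite scale1r //; exact: sE.
rewrite /= ltnS => ks sE EN.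
have le : linear (fun a : R^o => (a : R) *: e).
  by move=> a b c; rewrite scalerDl -scalerA.
have [Q [q [q_surj qe]]] := cokernel (mkHom le).
have [|x|f x|r rN rQ] := IH Q (map q s); first by rewrite size_map.
- have [y <-] := q_surj x; have [a /(in_span_map q)] := sE y.
  have qe0 : q (a *: e) = 0 by apply/qe; exists a.
  by rewrite linearB qe0 subr0.
- by have [y <-] := q_surj x; exact: (EN (hcomp f q)).
have rE x : exists a, r *: x = a *: e.
  have /qe[a ax] : q (r *: x) = 0 by rewrite linearZ /= rQ.
  by exists a; rewrite -ax.
have [||r' r'e r'N] := @regular_in_ideal (fun a : R^o => (a : R) *: e = 0).
- split=> [|a b c be ce]; first by rewrite scale0r.
  by rewrite scalerDl -scalerA be ce scaler0 addr0.
- move=> n en; apply: rN.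
  have [x|a x y x' y' [b [bx ->]] [b' [bx' ->]]|y [b [be ->]]|f fP] :=
    @rel_hom _ E N (fun x y => exists b, r *: x = b *: e /\ y = b *: n).
  + by have [b bx] := rE x; exists (b *: n), b.
  + exists (a * b + b'); rewrite !scalerDl -!scalerA; split=> //.
    by rewrite scalerDr (scalerA r) [r * a]mulrC -scalerA bx bx'.
  + by apply: en; rewrite -be scaler0.
  have [b [be fe]] := fP e; rewrite EN in fe.
  have : (b - r) *: n = 0 by apply: en; rewrite scalerBl -be subrr.
  by rewrite scalerBl -fe sub0r => /eqP; rewrite oppr_eq0 => /eqP.
exists (r' * r) => [|x]; first exact: regular_mul.
have [a ax] := rE x.
by rewrite -scalerA ax scalerA mulrC -scalerA r'e scaler0.
Qed.

End MaximalAnnihilators.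
End Noetherian.

(** * [Ext_kill] against Ext, and extension problems with torsion cokernel *)

Section Comparison.
Variable R : comPzRingType.
Implicit Types (a b : R) (A B K N Z : lmodType R).

Lemma homology_kill A B K (u : HomR A B) (v : HomR B K) a :
  (forall e : homology u v, a *: e = 0) <->
  (forall y, v y = 0 -> exists x, u x = a *: y).
Proof.
split=> [H y /eqP vy|H e].
  by have /homology_pi0 := etrans (esym (homology_piZ u a (Ker (f := v) vy))) (H _).
have [[y vy] ->] := homology_pi e; rewrite homology_piZ; apply/homology_pi0/H.
exact/eqP.
Qed.

Lemma Ext_kill_syz N a l A m :
  Ext_kill N a l (syz A m) <-> Ext_kill N a 0 (syz A (l + m)).
Proof.
elim: l m => // l IH m; rewrite addSnnS; exact: IH m.+1.
Qed.

(** The canonical resolution is spliced from the same free covers: cocycles in degree l + 1 are the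
    maps out of [syz A l.+1], and coboundaries are those extending to [fres A l]. *)
Lemma Ext_killP N a l A :
  (forall e : Ext A N l.+1, a *: e = 0) <-> Ext_kill N a l A.
Proof.
rewrite -[A in X in _ <-> X]/(syz A 0) Ext_kill_syz addn0.
have [j_inj p_surj j_p] := ses_aug (syz A l).
have [j'_inj p'_surj j'_p] := ses_aug (syz A l.+1).
split=> [/homology_kill H h|H].
  have [|g gP] := H (hcomp h (aug (syz A l.+1))).
    apply: Hom_eq => x.
    rewrite -[LHS]/(h (aug (syz A l.+1)
      (ker_incl (aug (syz A l.+1)) (aug (syz A l.+2) x)))).
    by rewrite (ses0 _ (ses_aug (syz A l.+1))) linear0.
  exists g => x; have [y <-] := p'_surj x.
  exact: (congr1 (fun f : HomR _ _ => f y) gP).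
apply/homology_kill => f fd.
have [|h hP] := hom_factor (f := f) p'_surj.
  move=> x /j'_p[y <-]; have [z <-] := aug_surj y.
  exact: (congr1 (fun f : HomR _ _ => f z) fd).
have [g gP] := H h; exists g; apply: Hom_eq => x.
by rewrite -[LHS]/(g (ker_incl _ (aug _ _))) gP hP.
Qed.

Lemma Ext_zeroP N l A : zero_module (Ext A N l.+1) <-> Ext_kill N 1 l A.
Proof.
rewrite -Ext_killP; split=> E0 e; first by rewrite scale1r; exact: E0.
by rewrite -[e]scale1r; exact: E0.
Qed.

Lemma Ext0_zero N A : (forall (f : HomR A N) x, f x = 0) -> zero_module (Ext A N 0).
Proof.
move=> A0 e; rewrite -[e]scale1r; move: e; apply/homology_kill => f fd.
have [_ p_surj j_p] := ses_aug A.
have [|h hP] := hom_factor (f := f) p_surj.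
  move=> x /j_p[y <-]; have [z <-] := aug_surj y.
  exact: (congr1 (fun f : HomR _ _ => f z) fd).
exists 0; apply: Hom_eq => x; rewrite linear0 scale1r.
by rewrite -[LHS]/0 -hP A0.
Qed.

(** Let B be the image of u. As y kills Z/B, b y kills the Ext of B, and 0 -> K -> A -> B -> 0 with
    A acyclic carries this over to K and to the extension problem. *)
Lemma torsion_extension N (y : R) b A Z K (u : HomR A Z) (i : HomR K A) :
    injective i -> (forall x, u x = 0 <-> exists z, i z = x) ->
    (forall z, exists x, u x = y *: z) ->
    (forall l, Ext_kill N 1 l A) -> (forall l, Ext_kill N b l Z) ->
  (forall l, Ext_kill N (b * y) l K) /\
  (forall f : HomR K N, exists g : HomR A N, forall x, g (i x) = (b * y) *: f x).
Proof.
move=> i_inj iu uy kA kZ; have [Q [q [q_surj qu]]] := cokernel u.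
have Qy (x : Q) : y *: x = 0.
  have [z <-] := q_surj x; have [x' ux'] := uy z.
  by rewrite -linearZ; apply/qu; exists x'.
have q_ses := ses_ker q_surj; have [B_inj _ Bq] := q_ses.
have kB l : Ext_kill N (b * y) l (kermod q).
  by apply: (Ext_kill_left q_ses) => //; exact: Ext_kill_torsion.
have [|c cP] := hom_lift_inj (f := u) B_inj.
  by move=> x; apply/Bq/qu; exists x.
have ic : ses i c.
  split=> // [z|x].
    have /qu[x ux] : q (ker_incl q z) = 0 by exact: (ses0 z q_ses).
    by exists x; apply: B_inj; rewrite cP.
  rewrite -iu -cP; split=> [->|]; first by rewrite linear0.
  by rewrite -[0 in X in X -> _](linear0 (ker_incl q)) => /B_inj.
split=> [l|f]; last exact: (Ext_kill_ext (kB 0%N) ic).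
by rewrite -[b * y]mul1r; apply: (Ext_kill_left ic).
Qed.

End Comparison.

(** * Cokernels of the dualised resolution *)

Section Resolution.
Variables (R : comPzRingType) (C : lmodType R).
Variables (X Y : nat -> lmodType R).
Variables (p : forall k, HomR (X k) (Y k)) (j : forall k, HomR (Y k.+1) (X k)).
Hypothesis XY : forall k, ses (j k) (p k).
Hypothesis X_acyclic : forall k l, Ext_kill C 1 l (X k).
Hypothesis X_dual_acyclic : forall k l, Ext_kill C 1 l (HomR (X k) C).
Hypothesis X_bidual : forall k, bijective (@biduality R C (X k)).

(* r annihilates the cokernel of Hom(X k, C) -> Hom(Y k.+1, C), which is *)
(* Ext^(k+1)(Y 0, C).                                                    *)
Definition coker_kill (r : R) (k : nat) :=
  forall f : HomR (Y k.+1) C, exists g : HomR (X k) C,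
    forall y, g (j k y) = r *: f y.

Lemma coker_kill_mull a r k : coker_kill r k -> coker_kill (a * r) k.
Proof.
move=> rk f; have [g gP] := rk f; exists (a *: g) => y.
by rewrite hom_scaleE gP scalerA.
Qed.

(** The X k are acyclic but need not be projective, so Ext^1 of Y m is computed from X m through a
    pullback with the free cover; [Ext_kill_right] then shifts down to Y 0. *)
Lemma coker_kill_Ext r k : coker_kill r k -> Ext_kill C r k (Y 0).
Proof.
have kill0 m : coker_kill r m -> Ext_kill C r 0 (Y m).
  move=> rm h.
  have [P [q [q' [i [i' [iq' i'q _ iE i'E]]]]]] := pullback (ses_aug (Y m)) (XY m).
  have [h1 h1P] := Ext_kill_ext (X_acyclic m 0) iq' h.
  have [g gP] := rm (hcomp h1 i'); have [_ q_surj i'_q] := i'q.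
  have [|e eP] := hom_factor (f := r *: h1 - hcomp g q') q_surj.
    move=> x /i'_q[y <-].
    by rewrite hom_subE hom_scaleE hcompE i'E gP hcompE subrr.
  exists e => x; rewrite -iE eP hom_subE hom_scaleE hcompE h1P scale1r.
  by rewrite (ses0 x iq') linear0 subr0.
suff H l m : coker_kill r (l + m) -> Ext_kill C r l (Y m).
  by move=> rk; apply: H; rewrite addn0.
elim: l m => [|l IH] m; first exact: kill0.
rewrite addSnnS => /IH rl; rewrite -[r]mulr1.
exact: (Ext_kill_right (XY m)).
Qed.

Let d k := hcomp (j k) (p k.+1).

Lemma d_exact k x : d k x = 0 <-> exists x', d k.+1 x' = x.
Proof.
have [j_inj _ _] := XY k; have [_ p_surj jp] := XY k.+1.
have -> : d k x = 0 <-> p k.+1 x = 0.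
  rewrite /d hcompE; split=> [|->]; last by rewrite linear0.
  by rewrite -[0](linear0 (j k)) => /j_inj.
split=> [/jp[y <-]|[x' <-]].
  by have [_ q_surj _] := XY k.+2; have [x' <-] := q_surj y; exists x'.
by apply/jp; exists (p k.+2 x').
Qed.

Variable n : nat.
Hypothesis Y_zero : forall k, (n < k)%N -> zero_module (Y k).
Hypothesis noethR : noetherian R.
Hypothesis fgX : forall k, fgmod (X k).
Hypothesis fgC : fgmod C.

Section Torsion.
Variables (N : lmodType R) (y : R).

Hypothesis X_dual_acyclicN : forall k l, Ext_kill N 1 l (HomR (X k) C).

(** Dualising 0 -> Y k.+1 -> X k -> Y k -> 0 leaves a cokernel killed by y, so [torsion_extension]
    applies to the dual of j k, whose kernel is the dual of Y k. *)
Lemma dual_torsion_extension b k : coker_kill y k ->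
    (forall l, Ext_kill N b l (HomR (Y k.+1) C)) ->
  (forall l, Ext_kill N (b * y) l (HomR (Y k) C)) /\
  (forall f : HomR (HomR (Y k) C) N, exists g : HomR (HomR (X k) C) N,
     forall x, g (hdual C (p k) x) = (b * y) *: f x).
Proof.
have [j_inj p_surj jp] := XY k.
move=> yk kY; apply: (torsion_extension (u := hdual C (j k))) => //.
- move=> f g fg; apply: Hom_eq => x; have [z <-] := p_surj x.
  exact: (congr1 (fun f : HomR _ _ => f z) fg).
- move=> f; split=> [fj|[g <-]].
    have [|g gP] := hom_factor (f := f) p_surj.
      by move=> x /jp[z <-]; exact: (congr1 (fun f : HomR _ _ => f z) fj).
    by exists g; apply: Hom_eq.
  by apply: Hom_eq => x; rewrite !hdualE (ses0 x (XY k)) linear0.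
- move=> f; have [g gP] := yk f; exists g; exact: Hom_eq.
Qed.

(** Descending from Y k = 0 for k > n, each step contributes one factor y. *)
Lemma dual_torsion k : (forall k', (k <= k')%N -> coker_kill y k') ->
  exists m, forall l, Ext_kill N (y ^+ m) l (HomR (Y k) C).
Proof.
have [t] := ubnP (n.+1 - k)%N; elim: t k => // t IH k kt yk.
have [nk|kn] := ltnP n k.
  exists 0%N => l; rewrite expr0; apply: Ext_kill_zero => f; apply: Hom_eq => x.
  by rewrite (Y_zero nk x) !linear0.
have [||m mP] := IH k.+1; first by rewrite subSS -ltnS -subSn.
  by move=> k' /ltnW; exact: yk.
exists m.+1; rewrite exprSr.
by have [] := dual_torsion_extension (yk k (leqnn k)) mP.
Qed.

End Torsion.

(** For c a power of y, c f extends to a map z on the dual of X k.+1. It vanishes on the image of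
    the dual of X k, so it factors through the dual of d k.+1, which is zero on the dual of Y k.+1.
    Hence c f = 0, and c is N-regular. *)
Lemma coker_hom_zero g N y k (f : HomR (HomR (Y k.+1) C) N) :
    regular_quotient C g N -> (g <= k)%N -> regular_on y N ->
    (forall k', (k < k')%N -> coker_kill y k') ->
    (forall h, f (hdual C (j k) h) = 0) ->
  forall h, f h = 0.
Proof.
move=> CN gk yN yk fj.
have XN k' l : Ext_kill N 1 l (HomR (X k') C).
  exact: (regular_quotient_acyclic CN (X_dual_acyclic k')).
have [|m mP] := @dual_torsion N y XN k.+2; first by move=> k' /ltnW; exact: yk.
have [_ /(_ f)[z zP]] := dual_torsion_extension XN (yk k.+1 (ltnSn k)) mP.
have cN : regular_on (y ^+ m * y) N.
  rewrite -exprSr; elim: m.+1 => [x|s IH]; first by rewrite expr0 scale1r.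
  by rewrite exprS; exact: regular_mul.
have [|u uP] := bidual_exact X_bidual X_dual_acyclic d_exact CN gk (z := z).
  move=> h; have -> : hdual C (d k) h = hdual C (p k.+1) (hdual C (j k) h).
    exact: Hom_eq.
  by rewrite zP fj scaler0.
move=> h; apply: cN; rewrite -zP uP.
have -> : hdual C (d k.+1) (hdual C (p k.+1) h) = 0.
  by apply: Hom_eq => x; rewrite !hdualE (ses0 _ (XY k.+1)) linear0.
by rewrite linear0.
Qed.

Lemma fgmod_regular_quotient g N : regular_quotient C g N -> fgmod N.
Proof.
by elim=> // g' N1 N2 r q _ fgN [_ q_surj _]; exact: fgmod_quotient fgN.
Qed.

(** Descending induction on k, with r = 1 above n. The y found for k + 1 makes [coker_hom_zero]
    apply at k, [regular_annihilator] turns that vanishing into a regular r, and r y serves from k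
    on. *)
Lemma regular_coker_kill g N k : regular_quotient C g N -> (g <= k)%N ->
  exists2 r, regular_on r N & forall k', (k <= k')%N -> coker_kill r k'.
Proof.
move=> CN; have [t] := ubnP (n.+1 - k)%N; elim: t k => // t IH k kt gk.
have [nk|kn] := ltnP n k.
  exists 1 => [x|k' kk' f]; first by rewrite scale1r.
  exists 0 => y; rewrite (Y_zero (leq_trans nk (leqW kk')) y).
  by rewrite !linear0.
have [||y yN yk] := IH k.+1; [by rewrite subSS -ltnS -subSn|exact: leqW|].
have [E [q [q_surj qj]]] := cokernel (hdual C (j k)).
have [_ p_surj _] := XY k.+1.
have fgE : fgmod E.
  apply: (fgmod_quotient q_surj); apply: fgmod_hom => //.
  exact: (fgmod_quotient p_surj).
have [|r rN rE] := regular_annihilator noethR (fgmod_regular_quotient CN) fgE.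
  move=> f x; have [z <-] := q_surj x.
  apply: (coker_hom_zero (f := hcomp f q) CN gk yN yk) => h.
  by rewrite hcompE; have /qj-> : exists h', hdual C (j k) h' = hdual C (j k) h;
    [exists h|rewrite linear0].
exists (r * y) => [|k']; first exact: regular_mul.
rewrite leq_eqVlt => /orP[/eqP<-|/yk]; last exact: coker_kill_mull.
rewrite mulrC; apply: coker_kill_mull => f.
have /qj[h hP] : q (r *: f) = 0 by rewrite linearZ /= rE.
by exists h => x; rewrite -hom_scaleE -hP.
Qed.

End Resolution.

(** * Syzygies of a totally reflexive resolution *)

Section TotallyReflexive.
Variables (R : comPzRingType) (C : lmodType R).

(** Pads a resolution beyond its length, so that the assumptions on X hold in every degree. *)
Lemma zero_totally_reflexive (X : lmodType R) :
  zero_module X -> totally_reflexive C X.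
Proof.
move=> X0; have X'0 : zero_module (HomR X C).
  by move=> f; apply: Hom_eq => x; rewrite (X0 x) !linear0.
split=> [||i i_gt0|i i_gt0].
- by exists 0%N, (fun=> 0) => x; exists (fun=> 0); rewrite (X0 x) big_ord0.
- exists (fun=> 0) => [x|f]; first by rewrite (X0 x).
  by apply: Hom_eq => g; rewrite (X'0 g) !linear0.
- by case: i i_gt0 => // i _; apply/Ext_zeroP; exact: Ext_kill_zero.
- by case: i i_gt0 => // i _; apply/Ext_zeroP; exact: Ext_kill_zero.
Qed.

Lemma GC_resolution_syzygies (M : lmodType R) n : GC_resolution C M n ->
  exists (X Y : nat -> lmodType R) (p : forall k, HomR (X k) (Y k))
         (j : forall k, HomR (Y k.+1) (X k)),
    [/\ Y 0%N = M, forall k, ses (j k) (p k), forall k, totally_reflexive C (X k) &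
        forall k, (n < k)%N -> zero_module (Y k)].
Proof.
move=> [X [d [e [X_refl X_zero e_surj de dd]]]].
(* Placing M before X 0 makes the augmentation e a differential like the others. *)
pose X' k : lmodType R := if k is k'.+1 then X k' else M.
pose d' k : HomR (X k) (X' k) :=
  match k return HomR (X k) (X' k) with 0%N => e | k'.+1 => d k' end.
pose Y k : lmodType R := if k is k'.+1 then kermod (d' k') else M.
have d'd k x : d' k x = 0 <-> exists x', d k x' = x by case: k x.
have exP k : exists p : HomR (X k) (Y k), ses (ker_incl (d' k)) p.
  case: k => [|k]; first by exists e; exact: ses_ker.
  have j_inj : injective (ker_incl (d' k)) by exact: val_inj.
  have [x|p pP] := hom_lift_inj (f := d k : HomR (X k.+1) (X k)) j_inj.
    have dx : d k x \in ker_pred (d' k) by rewrite inE; apply/eqP/d'd; exists x.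
    by exists (Ker dx).
  exists p; split=> [|y|x]; first exact: val_inj.
    have /d'd[x xy] : d' k (ker_incl (d' k) y) = 0 by apply/eqP; exact: (valP y).
    by exists x; apply: j_inj; rewrite pP.
  have -> : p x = 0 <-> d' k.+1 x = 0.
    rewrite -[d' _ x]pP; split=> [->|px]; first by rewrite linear0.
    by apply: j_inj; rewrite px linear0.
  split=> [/eqP dx|[y <-]]; first by exists (Ker (f := d' k.+1) dx).
  by apply/eqP; exact: (valP y).
pose p k := projT1 (cid (exP k)).
have pP k : ses (ker_incl (d' k)) (p k) := projT2 (cid (exP k)).
exists X, Y, p, (fun k => ker_incl (d' k)); split=> // k.
  by have [/X_refl|/X_zero/zero_totally_reflexive] := leqP k n.
move=> nk y; have [_ p_surj _] := pP k; have [x <-] := p_surj y.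
by rewrite (X_zero k nk x) linear0.
Qed.

Lemma GCdim_resolution (M : lmodType R) :
  GCdim C M <> None -> exists n, GC_resolution C M n.
Proof.
by rewrite /GCdim /einf; case: pselect => // -[n /asboolP Mn] _; exists n.
Qed.

End TotallyReflexive.

(** * From C-regular elements to the vanishing of Ext into R *)

Section ExtHom.
Variables (R : comPzRingType) (C : lmodType R).

Lemma Ext_kill_coef_retract (N N' : lmodType R) (u : HomR N N') (v : HomR N' N) a l A :
  cancel u v -> Ext_kill N' a l A -> Ext_kill N a l A.
Proof.
move=> uK; elim: l A => [|l IH] A; last exact: IH.
move=> kA h; have [g gP] := kA (hcomp u h); exists (hcomp v g) => x.
by rewrite hcompE gP hcompE linearZ /= uK.
Qed.

(** Right exactness is preserved because Ext^1(A, N) = 0. With A = C this carries regular elements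
    from N to Hom(C, N). *)
Lemma hom_ses_homothety (A N N' : lmodType R) r (q : HomR N N') :
    ses (homothety N r) q -> Ext_kill N 1 0 A ->
  exists q' : HomR (HomR A N) (HomR A N'), ses (homothety (HomR A N) r) q'.
Proof.
move=> rq kA.
have lq : linear (fun f : HomR A N => hcomp q f : HomR A N').
  by move=> a f g; apply: Hom_eq => x; rewrite !hcompE linearP.
exists (mkHom lq); split=> [|f|f].
- apply: inj_hom => f rf; apply: Hom_eq => x.
  apply: (ses_homothety_regular rq).
  exact: (congr1 (fun f : HomR _ _ => f x) rf).
- have [g gP] := hom_lift_quotient rq f kA.
  by exists g; apply: Hom_eq.
- split=> [qf|[g <-]].
    have [x|g gP] := ses_homothety_div rq (f := f).
      exact: (congr1 (fun f : HomR _ _ => f x) qf).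
    by exists g; apply: Hom_eq.
  by apply: Hom_eq => x; exact: (ses_homothety0 rq).
Qed.

Variables (E : lmodType R) (i : nat).
Hypothesis C_acyclic : forall l, Ext_kill C 1 l C.
Hypothesis E_torsion : forall g N, regular_quotient C g N -> (g < i)%N ->
  exists2 r, regular_on r N & forall x : E, r *: x = 0.

Lemma hom_hom_zero g N : regular_quotient C g N -> (g < i)%N ->
  forall (f : HomR E (HomR C N)) x, f x = 0.
Proof.
move=> CN gi f x; have [r rN rE] := E_torsion CN gi.
apply: Hom_eq => c; apply: rN.
by rewrite -hom_scaleE -linearZ /= rE linear0.
Qed.

(** Induction on l, trading one degree for one more regular element: r kills E, hence the Ext group,
    while the vanishing one degree lower for N/rN makes r injective on it. *)
Lemma Ext_hom_zero l g N : regular_quotient C g N -> (g + l.+1 < i)%N ->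
  Ext_kill (HomR C N) 1 l E.
Proof.
have step g' N' : regular_quotient C g' N' -> (g' < i)%N ->
    exists N1 r (q : HomR (HomR C N') (HomR C N1)),
      [/\ regular_quotient C g'.+1 N1, ses (homothety (HomR C N') r) q &
          forall x : E, r *: x = 0].
  move=> CN' /(E_torsion CN')[r rN rE].
  have [N1 [q [rq CN1]]] := regular_quotient_next CN' rN.
  have [q' rq'] := hom_ses_homothety rq (regular_quotient_acyclic CN' C_acyclic 0).
  by exists N1, r, q'.
elim: l g N => [|l IH] g N CN; rewrite addnS => gl.
  have [|N' [r [q [CN' rq rE]]]] := step g N CN.
    by rewrite -[g]addn0 ltnW.
  apply: (Ext_kill_regular0 rq); first exact: Ext_kill_torsion.
  by apply: hom_hom_zero CN' _; rewrite -[g]addn0.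
have [|N' [r [q [CN' rq rE]]]] := step g N CN.
  by rewrite (leq_trans _ gl) // ltnS leqW // leq_addr.
apply: (Ext_kill_regular rq); first exact: Ext_kill_torsion.
by apply: IH CN' _; rewrite addSn.
Qed.

Hypothesis C_homothety : bijective (homothety C).

(** The homothety map identifies R with Hom(C, C), so this is the case g = 0, N = C of the vanishing
    into Hom(C, N). *)
Lemma Ext_ring_zero l : (l < i)%N -> zero_module (Ext E R^o l).
Proof.
have lh : linear (homothety C : R^o -> HomR C C).
  by move=> a b c; apply: Hom_eq => x; rewrite [LHS]scalerDl -scalerA.
have h_inj : injective (mkHom lh) by exact: bij_inj C_homothety.
have [f|v vP] := hom_lift_inj (f := idfun : HomR (HomR C C) (HomR C C)) h_inj.
  by have [h' _ hK] := C_homothety; exists (h' f); exact: hK.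
have vK : cancel (mkHom lh) v by move=> a; apply: h_inj; rewrite vP.
case: l => [|l] li.
  apply: Ext0_zero => f x; apply: h_inj; rewrite linear0.
  exact: (hom_hom_zero (regular_quotient0 C) li (hcomp (mkHom lh) f)).
apply/Ext_zeroP; apply: Ext_kill_coef_retract vK _.
exact: (Ext_hom_zero (regular_quotient0 C)).
Qed.

End ExtHom.

Theorem proposition4p1 (R : comPzRingType)
    (noethR : noetherian R) (semiperfR : semiperfect R)
    (C : lmodType R) (sdC : semidualizing C)
    (M : lmodType R) (finM : finite_module M) (dimM : GCdim C M <> None)
    (i : nat) (i_gt0 : (0 < i)%N) :
  leqe i (grade (Ext M C i)).
Proof.
have [finC C_homothety C_Ext] := sdC.
have [n /GC_resolution_syzygies[X [Y [p [j [YM XY X_refl Y_zero]]]]]] :=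
  GCdim_resolution dimM.
(* The successor matches the indexing of [coker_kill]: index i concerns Ext^(i+1), and g < i.+1 is
   the bound g <= i of [regular_coker_kill]. *)
subst M; case: i i_gt0 => // i _.
have X_bidual k : bijective (biduality C (X := X k)) by have [] := X_refl k.
have X_acyclic k l : Ext_kill C 1 l (X k).
  by have [_ _ X0 _] := X_refl k; apply/Ext_zeroP/X0.
have X_dual_acyclic k l : Ext_kill C 1 l (HomR (X k) C).
  by have [_ _ _ X0] := X_refl k; apply/Ext_zeroP/X0.
have fgX k : fgmod (X k) by have [/finite_fgmod] := X_refl k.
have E_torsion g N : regular_quotient C g N -> (g < i.+1)%N ->
    exists2 r, regular_on r N & forall x : Ext (Y 0) C i.+1, r *: x = 0.
  move=> CN gi; have [r rN rk] := regular_coker_kill XY X_dual_acyclic X_bidual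
    Y_zero noethR fgX (finite_fgmod finC) CN gi.
  exists r => //; apply/Ext_killP.
  exact: (coker_kill_Ext XY X_acyclic (rk i (leqnn i))).
rewrite /grade /einf; case: pselect => //= exP.
case: ex_minnP => m /asboolP Em _; rewrite leqNgt; apply/negP => mi.
apply: Em; apply: (Ext_ring_zero _ E_torsion C_homothety mi) => l.
exact/Ext_zeroP/C_Ext.
Qed.
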